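(* For any $H\in(0,1)$, $\alpha\in(0,1)$ and $b\in\{2,3,\dots\}$, the fractional Wiener--Weierstra\ss\ bridge $X$ with parameters $\alpha,b,H$ is not a semimartingale.
   Context: Let $W=(W(t))_{t\ge0}$ be a fractional Brownian motion with Hurst parameter $H\in(0,1)$. Let $\kappa:[0,1]\to[0,1]$ be a deterministic function with $\kappa(0)=0$, $\kappa(1)=1$ that is H\''older continuous with some exponent $\tau\in(H,1]$. The fractional Brownian bridge is $B(t):=W(t)-\kappa(t)W(1)$, $t\in[0,1]$. For $x\ge0$, $\{x\}$ denotes the fractional part of $x$. For $\alpha\in(0,1)$, $b\in\{2,3,\dots\}$, the fractional Wiener--Weierstra\ss\ bridge is $X(t):=\sum_{n=0}^\infty\alpha^nB(\{b^nt\})$, $0\le t\le1$. *)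

(* Defs.v *)
From HB Require Import structures.
From mathcomp Require Import all_boot all_order all_algebra.
From mathcomp Require Import all_classical all_reals all_analysis.
Set Implicit Arguments. Unset Strict Implicit. Unset Printing Implicit Defensive.
Import Order.TTheory GRing.Theory Num.Theory.
Import numFieldNormedType.Exports.
Local Open Scope classical_set_scope.
Local Open Scope ring_scope.

Definition frac {R : realType} (x : R) : R := x - (Num.floor x)%:~R.

Definition centered_normal_law {R : realType} (v : R) (A : set R) : \bar R :=
  if v == 0 then \d_(0 : R) A else normal_prob 0 (Num.sqrt v) A.

Definition is_centered_gaussian d (Omega : measurableType d) (R : realType)
  (P : probability Omega R) (Y : Omega -> R) (v : R) : Prop :=
  measurable_fun setT Y /\
  forall A : set R, measurable A -> P (Y @^-1` A) = centered_normal_law v A.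

Definition fBm_cov {R : realType} (H s t : R) : R :=
  (s `^ (2 * H) + t `^ (2 * H) - `|t - s| `^ (2 * H)) / 2.

(* W is a fractional Brownian motion with Hurst index H on [0, oo):
   continuous paths and a centered Gaussian process with covariance fBm_cov,
   i.e. every finite linear combination is centered Gaussian with the
   corresponding variance. *)
Definition is_fBm d (Omega : measurableType d) (R : realType)
  (P : probability Omega R) (H : R) (W : R -> Omega -> R) : Prop :=
  (forall w, {within [set t : R | 0 <= t], continuous (fun t => W t w)}) /\
  forall (n : nat) (t : 'I_n -> R) (c : 'I_n -> R),
    (forall i, 0 <= t i) ->
    is_centered_gaussian P (fun w => \sum_(i < n) c i * W (t i) w)
      (\sum_(i < n) \sum_(j < n) c i * c j * fBm_cov H (t i) (t j)).

Definition fbridge {Omega : Type} {R : realType}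
  (W : R -> Omega -> R) (kappa : R -> R) (t : R) (w : Omega) : R :=
  W t w - kappa t * W 1 w.

Definition fWW_bridge {Omega : Type} {R : realType} (alpha : R) (b : nat)
  (W : R -> Omega -> R) (kappa : R -> R) (t : R) (w : Omega) : R :=
  limn (fun N : nat => \sum_(n < N)
          alpha ^+ n * fbridge W kappa (frac ((b%:R) ^+ n * t)) w).

Definition filtration d (Omega : measurableType d) (R : realType)
  (F : R -> set (set Omega)) : Prop :=
  (forall t, 0 <= t <= 1 -> sigma_algebra setT (F t) /\ F t `<=` measurable) /\
  (forall s t, 0 <= s -> s <= t -> t <= 1 -> F s `<=` F t).

Definition adapted d (Omega : measurableType d) (R : realType)
  (F : R -> set (set Omega)) (M : R -> Omega -> R) : Prop :=
  forall t, 0 <= t <= 1 -> forall A : set R, measurable A -> F t (M t @^-1` A).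

Definition martingale d (Omega : measurableType d) (R : realType)
  (P : probability Omega R) (F : R -> set (set Omega)) (M : R -> Omega -> R)
  : Prop :=
  adapted F M /\
  (forall t, 0 <= t <= 1 -> P.-integrable setT (EFin \o M t)) /\
  (forall s t, 0 <= s -> s <= t -> t <= 1 -> forall A, F s A ->
     (\int[P]_(w in A) (M t w)%:E = \int[P]_(w in A) (M s w)%:E)%E).

Definition stopping_time d (Omega : measurableType d) (R : realType)
  (F : R -> set (set Omega)) (tau : Omega -> \bar R) : Prop :=
  (forall w, (0 <= tau w)%E) /\
  (forall t, 0 <= t <= 1 -> F t [set w | (tau w <= t%:E)%E]).

Definition stopped {Omega : Type} {R : realType} (tau : Omega -> \bar R)
  (M : R -> Omega -> R) (t : R) (w : Omega) : R :=
  M (if (tau w < t%:E)%E then fine (tau w) else t) w.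

Definition local_martingale d (Omega : measurableType d) (R : realType)
  (P : probability Omega R) (F : R -> set (set Omega)) (M : R -> Omega -> R)
  : Prop :=
  exists tau : nat -> Omega -> \bar R,
    (forall n, stopping_time F (tau n)) /\
    (forall n w, (tau n w <= tau n.+1 w)%E) /\
    {ae P, forall w, exists n, (1%:E <= tau n w)%E} /\
    (forall n, martingale P F (stopped (tau n) M)).

Definition cadlag {R : realType} (f : R -> R) : Prop :=
  (forall t, 0 <= t < 1 -> f x @[x --> t^'+] --> f t) /\
  (forall t, 0 < t <= 1 -> exists l : R, f x @[x --> t^'-] --> l).

Definition semimartingale d (Omega : measurableType d) (R : realType)
  (P : probability Omega R) (F : R -> set (set Omega)) (X : R -> Omega -> R)
  : Prop :=
  adapted F X /\
  exists M A : R -> Omega -> R,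
    local_martingale P F M /\ adapted F A /\
    {ae P, forall w,
      cadlag (fun t => M t w) /\ cadlag (fun t => A t w) /\
      bounded_variation 0 1 (fun t => A t w) /\
      M 0 w = 0 /\ A 0 w = 0 /\
      (forall t, 0 <= t <= 1 -> X t w = X 0 w + M t w + A t w)}.

(* Main.v *)
(* Let V(u) = X(u + 1/b) - X(u) and V'(u) = X(u/b^2 + 1/b^3) - X(u/b^2).  Since the fractional parts of
   b^n u and b^n (u + 1/b) agree for n >= 1, V(u) is just B(u + 1/b) - B(u); in the same way V'(u) is a
   sum of two increments of B at smaller scales and of alpha^2 V(u).  So the path of X up to time b^(-2)
   contains a noisy copy of the later path of V.  On a grid of n points in [b^(-2), b^(-2) + b^(-5)] the
   increments Y_i of V' and G_i of V are jointly Gaussian, and their correlation is bounded away from 0: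
   for a mesh delta, the covariance of separated increments of W is O(delta^2), and the Hoelder
   continuity of kappa makes the bridge correction o(delta^H), whereas G_i has size delta^H.  Betting on
   G_i with the truncation theta_i of Y_i, which is bounded and known at time b^(-2), gives a sum S of
   the theta_i G_i with E S >= c g and |S|_2 <= g, where g, the sum of the |G_i|_2, is at least c n^(1-H)
   and tends to infinity.  Then S is not tight.  But S is a difference of two elementary stochastic
   integrals of X with bounded integrands, and these are tight when X is a semimartingale: the finite
   variation part is bounded by its variation, and the martingale part satisfies a weak-type
   inequality. *)
Require Import Defs.
From HB Require Import structures.
From mathcomp Require Import all_boot all_order all_algebra.
From mathcomp Require Import all_classical all_reals all_analysis.
From mathcomp Require Import measurable_realfun ring lra.
Set Implicit Arguments. Unset Strict Implicit. Unset Printing Implicit Defensive.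
Import Order.TTheory GRing.Theory Num.Theory.
Import numFieldNormedType.Exports.
Local Open Scope classical_set_scope.
Local Open Scope ring_scope.

(** * Square-integrable random variables *)

(** For H = 1/2 the process W is itself a semimartingale, so an argument uniform in H cannot rest on
    the roughness of W alone. It rests on predictability, which is available in every filtration to
    which X is adapted because the weights are functions of values of X. Two powers of b separate
    the copy from the original for every base. With u/b instead of u/b^2 and b = 2, the copy X(u/2 +
    1/4) - X(u/2) is known by time u only if u >= 1/2, while the reduction of V(u) to a single
    increment of B needs u + 1/2 < 1. Each Y_i is divided by its standard deviation, so all of them
    have the same standard normal law and one clipping level L, fixed before the mesh, serves every
    interval of every grid. Non-tightness of S comes from two moments only: Cauchy-Schwarz on the
    event |S| > K gives E S <= K + sqrt(P(|S| > K)) |S|_2. If the probability is small compared with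
    c^2, then E S >= c g and |S|_2 <= g force K to be at least of order g. *)

Section square_integrable.
Context d (T : measurableType d) (R : realType) (P : probability T R).
Implicit Types f g : T -> R.

Definition L1 f := P.-integrable setT (EFin \o f).
Definition Ex f : R := \int[P]_x f x.
Definition L2 f := measurable_fun setT f /\ L1 (fun x => f x ^+ 2).
Definition nrm2 f := Num.sqrt (Ex (fun x => f x ^+ 2)).

Lemma measurable_gt f K : measurable_fun setT f ->
  measurable [set x | K < f x].
Proof.
move=> mf; rewrite -[X in measurable X]setTI.
have -> : [set x | K < f x] = f @^-1` `]K, +oo[.
  by apply/seteqP; split=> x /=; rewrite in_itv/= andbT.
exact: mf.
Qed.

Lemma L1_measurable f : L1 f -> measurable_fun setT f.
Proof. by move=> /measurable_int /measurable_EFinP. Qed.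

Lemma L1_le f g : measurable_fun setT f -> (forall x, `|f x| <= `|g x|) ->
  L1 g -> L1 f.
Proof.
move=> mf fg; apply: le_integrable => //; first exact/measurable_EFinP.
by move=> x _ /=; rewrite lee_fin.
Qed.

Lemma L1_bounded f K : measurable_fun setT f -> (forall x, `|f x| <= K) -> L1 f.
Proof.
move=> mf fK; apply: (@L1_le _ (cst K)) => //.
  by move=> x /=; apply: le_trans (ler_norm _).
exact: finite_measure_integrable_cst.
Qed.

Lemma L1_cst k : L1 (fun=> k).
Proof. exact: finite_measure_integrable_cst. Qed.

Lemma indic_norm_le1 (A : set T) x : `|\1_A x : R| <= 1.
Proof. by rewrite indicE; case: (_ \in _); rewrite ?normr1 ?normr0. Qed.

Lemma L1_indic A : measurable A -> L1 \1_A.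
Proof. by move=> mA; apply: (L1_bounded _ (indic_norm_le1 A)). Qed.

Lemma L1D f g : L1 f -> L1 g -> L1 (fun x => f x + g x).
Proof. by move=> Lf Lg; exact: integrableD Lf Lg. Qed.

Lemma L1Z k f : L1 f -> L1 (fun x => k * f x).
Proof. by move=> Lf; exact: integrableZl Lf. Qed.

Lemma L1B f g : L1 f -> L1 g -> L1 (fun x => f x - g x).
Proof. by move=> Lf Lg; exact: integrableB Lf Lg. Qed.

Lemma L1_norm f : L1 f -> L1 (fun x => `|f x|).
Proof. exact: integrable_norm. Qed.

Lemma L1_sum (I : Type) (s : seq I) (Q : pred I) (f : I -> T -> R) :
  (forall i, Q i -> L1 (f i)) -> L1 (fun x => \sum_(i <- s | Q i) f i x).
Proof.
move=> Lf; elim: s => [|i s ih].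
  by under eq_fun do rewrite big_nil; exact: L1_cst.
under eq_fun do rewrite big_cons.
by case E: (Q i) => //; apply: L1D => //; exact: Lf.
Qed.

Lemma L1_bounded_mul f g K : measurable_fun setT g -> (forall x, `|g x| <= K) ->
  L1 f -> L1 (fun x => g x * f x).
Proof.
move=> mg gK Lf; apply: (@L1_le _ (fun x => K * f x)).
- by apply: measurable_funM => //; exact: L1_measurable.
- move=> x; rewrite !normrM ler_wpM2r//.
  exact: le_trans (gK x) (ler_norm _).
- exact: L1Z.
Qed.

Lemma ExD f g : L1 f -> L1 g -> Ex (fun x => f x + g x) = Ex f + Ex g.
Proof. by move=> Lf Lg; rewrite /Ex RintegralD. Qed.

Lemma ExB f g : L1 f -> L1 g -> Ex (fun x => f x - g x) = Ex f - Ex g.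
Proof. by move=> Lf Lg; rewrite /Ex RintegralB. Qed.

Lemma ExZ k f : L1 f -> Ex (fun x => k * f x) = k * Ex f.
Proof. by move=> Lf; rewrite /Ex RintegralZl. Qed.

Lemma Ex_cst k : Ex (fun=> k) = k.
Proof. by rewrite /Ex Rintegral_cst// [X in fine X]probability_setT /= mulr1. Qed.

Lemma Ex_ge0 f : (forall x, 0 <= f x) -> 0 <= Ex f.
Proof. by move=> f0; apply: Rintegral_ge0. Qed.

Lemma Ex_le f g : L1 f -> L1 g -> (forall x, f x <= g x) -> Ex f <= Ex g.
Proof. by move=> Lf Lg fg; apply: le_Rintegral. Qed.

Lemma Ex_norm f : L1 f -> `|Ex f| <= Ex (fun x => `|f x|).
Proof. by move=> Lf; apply: le_normr_Rintegral. Qed.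

Lemma Ex_sum (I : Type) (s : seq I) (Q : pred I) (f : I -> T -> R) :
  (forall i, Q i -> L1 (f i)) ->
  Ex (fun x => \sum_(i <- s | Q i) f i x) = \sum_(i <- s | Q i) Ex (f i).
Proof.
move=> Lf; elim: s => [|i s ih].
  under [X in Ex X]eq_fun do rewrite big_nil.
  by rewrite big_nil Ex_cst.
under [X in Ex X]eq_fun do rewrite big_cons.
rewrite big_cons; case E: (Q i) => //; rewrite ExD ?ih//; first exact: Lf.
exact: L1_sum.
Qed.

Lemma Ex_indic A : measurable A -> Ex \1_A = fine (P A).
Proof.
by move=> mA; rewrite /Ex /Rintegral integral_indic// setIT.
Qed.

Lemma L2M f g : L2 f -> L2 g -> L1 (fun x => f x * g x).
Proof.
move=> [mf Lf] [mg Lg]; apply: (@L1_le _ (fun x => f x ^+ 2 + g x ^+ 2)).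
- exact: measurable_funM.
- move=> x; rewrite [leRHS]ger0_norm ?addr_ge0 ?sqr_ge0//.
  rewrite ler_norml; have := sqr_ge0 (f x - g x); have := sqr_ge0 (f x + g x).
  by have := sqr_ge0 (f x); have := sqr_ge0 (g x); nra.
- exact: L1D.
Qed.

Lemma L2_cst k : L2 (fun=> k).
Proof. by split => //; exact: L1_cst. Qed.

Lemma L2_bounded f K : measurable_fun setT f -> (forall x, `|f x| <= K) -> L2 f.
Proof.
move=> mf fK; split => //; apply: (@L1_bounded _ (K ^+ 2)).
  exact: measurable_funX.
by move=> x; rewrite normrX lerXn2r// nnegrE; apply: le_trans (fK x).
Qed.

Lemma L2_indic A : measurable A -> L2 \1_A.
Proof. by move=> mA; apply: (L2_bounded _ (indic_norm_le1 A)). Qed.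

Lemma L2_L1 f : L2 f -> L1 f.
Proof.
move=> Lf; have := L2M Lf (L2_cst 1).
by under eq_fun do rewrite mulr1.
Qed.

Lemma L2D f g : L2 f -> L2 g -> L2 (fun x => f x + g x).
Proof.
move=> Lf Lg; split; first exact: measurable_funD Lf.1 Lg.1.
under eq_fun do rewrite sqrrD -mulr_natl.
by apply: L1D; [apply: L1D; [exact: Lf.2|exact/L1Z/L2M]|exact: Lg.2].
Qed.

Lemma L2Z k f : L2 f -> L2 (fun x => k * f x).
Proof.
move=> [mf Lf]; split; first exact: measurable_funM.
by under eq_fun do rewrite exprMn; exact: L1Z.
Qed.

Lemma L2B f g : L2 f -> L2 g -> L2 (fun x => f x - g x).
Proof.
move=> Lf /(L2Z (-1)) Lg; have := L2D Lf Lg.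
by under eq_fun do rewrite mulN1r.
Qed.

Lemma L2_sum (I : Type) (s : seq I) (Q : pred I) (f : I -> T -> R) :
  (forall i, Q i -> L2 (f i)) -> L2 (fun x => \sum_(i <- s | Q i) f i x).
Proof.
move=> Lf; elim: s => [|i s ih].
  by under eq_fun do rewrite big_nil; exact: L2_cst.
under eq_fun do rewrite big_cons.
by case E: (Q i) => //; apply: L2D => //; exact: Lf.
Qed.

Lemma L2_bounded_mul f g K : measurable_fun setT g -> (forall x, `|g x| <= K) ->
  L2 f -> L2 (fun x => g x * f x).
Proof.
move=> mg gK [mf Lf]; split; first exact: measurable_funM.
under eq_fun do rewrite exprMn.
apply: (@L1_bounded_mul _ _ (K ^+ 2)) => //; first exact: measurable_funX.
by move=> x; rewrite normrX lerXn2r// nnegrE; apply: le_trans (gK x).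
Qed.

Lemma nrm2_ge0 f : 0 <= nrm2 f.
Proof. exact: sqrtr_ge0. Qed.

Lemma nrm2_sqr f : nrm2 f ^+ 2 = Ex (fun x => f x ^+ 2).
Proof. by rewrite sqr_sqrtr// Ex_ge0// => x; exact: sqr_ge0. Qed.

Lemma Ex_sqrD f g : L2 f -> L2 g -> Ex (fun x => (f x + g x) ^+ 2) =
  Ex (fun x => f x ^+ 2) + 2 * Ex (fun x => f x * g x) + Ex (fun x => g x ^+ 2).
Proof.
move=> Lf Lg; have Lfg := L2M Lf Lg.
have -> : (fun x => (f x + g x) ^+ 2) =
    (fun x => f x ^+ 2 + 2 * (f x * g x) + g x ^+ 2).
  by apply/funext => x; ring.
rewrite ExD ?ExD ?ExZ//; [exact: Lf.2|exact: L1Z| |exact: Lg.2].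
by apply: L1D; [exact: Lf.2|exact: L1Z].
Qed.

Lemma cauchy_schwarz_Ex f g : L2 f -> L2 g ->
  `|Ex (fun x => f x * g x)| <= nrm2 f * nrm2 g.
Proof.
move=> Lf Lg; set c := Ex _.
have key t : 0 <= nrm2 f ^+ 2 * t ^+ 2 + 2 * t * c + nrm2 g ^+ 2.
  rewrite !nrm2_sqr.
  have := Ex_sqrD (L2Z t Lf) Lg.
  have -> : (fun x => (t * f x) ^+ 2) = (fun x => t ^+ 2 * f x ^+ 2).
    by apply/funext => x; rewrite exprMn.
  have -> : (fun x => t * f x * g x) = (fun x => t * (f x * g x)).
    by apply/funext => x; rewrite mulrA.
  rewrite !ExZ; [|exact: L2M|exact: Lf.2] => H.
  have : 0 <= Ex (fun x => (t * f x + g x) ^+ 2).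
    by apply: Ex_ge0 => x; exact: sqr_ge0.
  by rewrite H -/c mulrA (mulrC (t ^+ 2)).
have [F0 G0] : 0 <= nrm2 f /\ 0 <= nrm2 g by rewrite !nrm2_ge0.
move: key F0 G0; move: (nrm2 f) (nrm2 g) => F G key F0 G0.
have : c ^+ 2 <= (F * G) ^+ 2.
  have [F00|F1] := eqVneq F 0.
    have [->|c0] := eqVneq c 0; first by rewrite expr0n/= sqr_ge0.
    (* With F = 0 the quadratic is affine in t; at this t its value is -1, against [key]. *)
    have := key (- (G ^+ 2 + 1) / (2 * c)); rewrite F00 expr0n/= !mul0r add0r.
    have -> : 2 * (- (G ^+ 2 + 1) / (2 * c)) * c = - (G ^+ 2 + 1) by field.
    by move=> h; exfalso; lra.
  have Fp : 0 < F by rewrite lt_def F1.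
  (* The minimiser of the quadratic, where its value is G^2 - c^2 / F^2. *)
  have := key (- c / F ^+ 2).
  have -> : F ^+ 2 * (- c / F ^+ 2) ^+ 2 + 2 * (- c / F ^+ 2) * c + G ^+ 2
     = ((F * G) ^+ 2 - c ^+ 2) / F ^+ 2 by field.
  by rewrite pmulr_lge0 ?invr_gt0 ?exprn_gt0// subr_ge0.
by move=> h; rewrite -[leRHS]ger0_norm ?mulr_ge0// -ler_sqr ?nnegrE// !real_normK ?num_real.
Qed.

Lemma nrm2D f g : L2 f -> L2 g -> nrm2 (fun x => f x + g x) <= nrm2 f + nrm2 g.
Proof.
move=> Lf Lg; rewrite -ler_sqr ?nnegrE ?addr_ge0 ?nrm2_ge0//.
rewrite sqrrD nrm2_sqr Ex_sqrD// -!nrm2_sqr lerD2r lerD2l -[leRHS]mulr_natl.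
by rewrite ler_wpM2l// (le_trans (ler_norm _))// cauchy_schwarz_Ex.
Qed.

Lemma nrm2_le f g : L2 f -> L2 g -> (forall x, `|f x| <= `|g x|) -> nrm2 f <= nrm2 g.
Proof.
move=> Lf Lg fg; rewrite ler_wsqrtr// Ex_le//; [exact: Lf.2|exact: Lg.2|].
move=> x; rewrite -(real_normK (num_real (f x))) -(real_normK (num_real (g x))).
by rewrite lerXn2r// ?nnegrE.
Qed.

Lemma nrm2Z k f : L2 f -> nrm2 (fun x => k * f x) = `|k| * nrm2 f.
Proof.
move=> Lf; rewrite /nrm2.
under [X in Ex X]eq_fun do rewrite exprMn.
rewrite ExZ; last exact: Lf.2.
by rewrite sqrtrM ?sqr_ge0// sqrtr_sqr.
Qed.

Lemma nrm2_sum (I : Type) (s : seq I) (f : I -> T -> R) :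
  (forall i, L2 (f i)) ->
  nrm2 (fun x => \sum_(i <- s) f i x) <= \sum_(i <- s) nrm2 (f i).
Proof.
move=> Lf; elim: s => [|i s ih].
  under [X in nrm2 X]eq_fun do rewrite big_nil.
  by rewrite big_nil /nrm2 expr0n/= Ex_cst sqrtr0.
under [X in nrm2 X]eq_fun do rewrite big_cons.
rewrite big_cons (le_trans (nrm2D _ _))//; first exact: L2_sum.
by rewrite lerD2l.
Qed.

Lemma nrm2_indic A : measurable A -> nrm2 \1_A = Num.sqrt (fine (P A)).
Proof.
move=> mA; rewrite /nrm2 -Ex_indic//; congr (Num.sqrt (Ex _)).
by apply/funext => x; rewrite indicE; case: (_ \in _); rewrite ?expr1n ?expr0n.
Qed.

Lemma chebyshev_Ex f K : L2 f -> 0 < K ->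
  fine (P [set x | K < `|f x|]) <= Ex (fun x => f x ^+ 2) / K ^+ 2.
Proof.
move=> Lf K0; have mA : measurable [set x | K < `|f x|].
  by apply: measurable_gt; exact: (measurableT_comp (@normr_measurable R setT) Lf.1).
rewrite ler_pdivlMr ?exprn_gt0// -Ex_indic// mulrC -ExZ; last first.
  exact: L1_indic.
apply: Ex_le; [exact/L1Z/L1_indic|exact: Lf.2|].
move=> x; rewrite indicE; have [/set_mem/= h|_] := boolP (_ \in _).
  by rewrite mulr1 -(real_normK (num_real (f x))) lerXn2r// ?nnegrE// ltW.
by rewrite mulr0 sqr_ge0.
Qed.

End square_integrable.

(** * Sub-sigma-algebras and conditional mean zero tested on events *)

Section sub_sigma_algebra.
Context d (T : measurableType d) (R : realType).

Definition sub_algebra (G : set (set T)) := sigma_algebra setT G /\ G `<=` measurable.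
Definition measurable_wrt (G : set (set T)) (f : T -> R) :=
  forall A : set R, measurable A -> G (f @^-1` A).

(** Transports relative measurability to [g_sigma_algebraType G], where the closure lemmas for sums,
    products and compositions apply; a sigma-algebra coincides with the one it generates. *)
Lemma measurable_wrtP (G : set (set T)) (f : T -> R) : sub_algebra G ->
  measurable_wrt G f <-> measurable_fun setT (f : g_sigma_algebraType G -> R).
Proof.
move=> [sG _]; split => [mf _ A mA|mf A mA].
  by rewrite setTI /measurable/= sigma_algebra_id//; exact: mf.
have := mf measurableT A mA.
by rewrite setTI /measurable/= sigma_algebra_id.
Qed.

Lemma measurable_wrt_measurable (G : set (set T)) (f : T -> R) : sub_algebra G ->
  measurable_wrt G f -> measurable_fun setT f.
Proof. by move=> [_ Gm] mf _ A mA; rewrite setTI; apply/Gm/mf. Qed.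

Lemma measurable_wrt_sub (G G' : set (set T)) (f : T -> R) : G `<=` G' ->
  measurable_wrt G f -> measurable_wrt G' f.
Proof. by move=> GG mf A mA; apply/GG/mf. Qed.

Variable P : probability T R.

Lemma Ex_indicM (A : set T) (f : T -> R) : measurable A ->
  Ex P (fun x => \1_A x * f x) = fine (\int[P]_(x in A) (f x)%:E).
Proof.
move=> mA; rewrite /Ex /Rintegral [in RHS]integral_mkcond; congr fine.
apply: eq_integral => x _; rewrite patchE indicE.
by case: ifP => _; rewrite ?mul1r ?mul0r.
Qed.

(** Passes from indicators to bounded nonnegative weights: [xi] is rounded down to multiples of a
    mesh [h], the rounded weight is a finite combination of indicators of events of [G], and the
    rounding costs at most [h] times the mean of |D|. No conditional expectation is constructed. *)
Lemma Ex_mul_wrt_bounded_eq0 (G : set (set T)) (D xi : T -> R) (B : R) :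
  sub_algebra G -> L1 P D ->
  (forall A, G A -> Ex P (fun x => \1_A x * D x) = 0) ->
  measurable_wrt G xi -> (forall x, 0 <= xi x <= B) ->
  Ex P (fun x => xi x * D x) = 0.
Proof.
move=> sG LD D0 mxi xiB.
have Lxi : L1 P (fun x => xi x * D x).
  apply: (@L1_bounded_mul _ _ _ _ _ _ B) => //.
    exact: measurable_wrt_measurable mxi.
  by move=> x; have /andP[x0 xB] := xiB x; rewrite ger0_norm.
apply/eqP; rewrite -normr_eq0; apply/eqP/le_anti; rewrite normr_ge0 andbT.
apply/ler_addgt0Pr => e e0; rewrite add0r.
pose E1 := Ex P (fun x => `|D x|).
have E10 : 0 <= E1 by exact: Ex_ge0.
(* This gives h E1 <= e; the added 1 covers E1 = 0. *)
pose h := e / (E1 + 1).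
have h0 : 0 < h by rewrite divr_gt0// ltr_pwDr.
pose N := (Num.truncn (B / h)).+1.
pose A k := xi @^-1` `[k%:R * h, k.+1%:R * h[.
have GA k : G (A k) by apply: mxi.
have mA k : measurable (A k) by apply: sG.2.
have L1A k : L1 P (fun x => \1_(A k) x * D x).
  exact: (L1_bounded_mul _ (indic_norm_le1 R (A k))).
pose xih x := \sum_(k < N) k%:R * h * \1_(A k) x.
have xihE x : xih x = (Num.truncn (xi x / h))%:R * h.
  have /andP[x0 xB] := xiB x.
  have kN : (Num.truncn (xi x / h) < N)%N.
    by rewrite ltnS; apply: le_truncn; rewrite ler_pM2r ?invr_gt0.
  rewrite /xih (bigD1 (Ordinal kN))//= big1 ?addr0 => [|i /eqP iN].
    rewrite indicE mem_set ?mulr1// /A/= in_itv/=.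
    have := truncn_itv (divr_ge0 x0 (ltW h0)).
    by rewrite ler_pdivlMr// ltr_pdivrMr.
  rewrite indicE memNset ?mulr0// /A/= in_itv/=.
  rewrite -ler_pdivlMr// -ltr_pdivrMr// => /truncn_def kE.
  by apply: iN; apply: val_inj => /=.
have ExhD : Ex P (fun x => xih x * D x) = 0.
  have -> : (fun x => xih x * D x) =
      (fun x => \sum_(k < N) (k%:R * h) * (\1_(A k) x * D x)).
    by apply/funext => x; rewrite /xih mulr_suml; apply: eq_bigr => k _; rewrite -[LHS]mulrA.
  rewrite Ex_sum => [|k _]; last exact: L1Z.
  by apply: big1 => k _; rewrite ExZ// D0// mulr0.
have LhD : L1 P (fun x => xih x * D x).
  have -> : (fun x => xih x * D x) =
      (fun x => \sum_(k < N) (k%:R * h) * (\1_(A k) x * D x)).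
    by apply/funext => x; rewrite /xih mulr_suml; apply: eq_bigr => k _; rewrite -[LHS]mulrA.
  by apply: L1_sum => k _; exact: L1Z.
rewrite -[X in `|X|]subr0 -{1}ExhD -ExB//.
apply: (le_trans (Ex_norm (L1B Lxi LhD))).
apply: (@le_trans _ _ (Ex P (fun x => h * `|D x|))).
  apply: Ex_le; [exact/L1_norm/L1B|exact/L1Z/L1_norm|] => x.
  rewrite -mulrBl normrM ler_wpM2r// xihE.
  have /andP[x0 xB] := xiB x.
  have := truncn_itv (divr_ge0 x0 (ltW h0)).
  rewrite ler_pdivlMr// ltr_pdivrMr// -natr1 mulrDl mul1r => /andP[h1 h2].
  by rewrite ler_norml; apply/andP; split; lra.
rewrite ExZ; last exact: L1_norm.
rewrite -/E1 /h mulrAC ler_pdivrMr ?ltr_pwDr// ler_wpM2l// ?ltW//.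
by rewrite ltrDl.
Qed.

(** Adding [B] makes the weight nonnegative, and the extra term [B * Ex P D] vanishes by the
    hypothesis applied to the whole space. *)
Lemma Ex_mul_wrt_eq0 (G : set (set T)) (D xi : T -> R) (B : R) :
  sub_algebra G -> L1 P D ->
  (forall A, G A -> Ex P (fun x => \1_A x * D x) = 0) ->
  measurable_wrt G xi -> (forall x, `|xi x| <= B) ->
  Ex P (fun x => xi x * D x) = 0.
Proof.
move=> sG LD D0 mxi xiB.
have mxiB : measurable_wrt G (fun x => xi x + B).
  apply/measurable_wrtP => //; apply: measurable_funD => //.
  exact/measurable_wrtP.
have B1 x : 0 <= xi x + B <= 2 * B.
  by have := xiB x; rewrite ler_norml => /andP[? ?]; apply/andP; split; lra.
have := @Ex_mul_wrt_bounded_eq0 G D (fun x => xi x + B) (2 * B) sG LD D0 mxiB B1.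
have -> : (fun x => (xi x + B) * D x) = (fun x => xi x * D x + B * D x).
  by apply/funext => x; rewrite mulrDl.
rewrite ExD//; last exact: L1Z; last first.
  by apply: (@L1_bounded_mul _ _ _ _ _ _ B) => //; exact: measurable_wrt_measurable mxi.
rewrite ExZ//.
have -> : Ex P D = 0; last by rewrite mulr0 addr0.
rewrite -(D0 setT); last first.
  have [G0 GC _] := sG.1.
  by rewrite -(setD0 setT); exact: GC.
by congr (Ex P _); apply/funext => x; rewrite indicT mul1r.
Qed.

End sub_sigma_algebra.

(** * Weak-type inequality for martingale transforms *)

Section truncation.
Context {R : realType}.
Implicit Types K y : R.

Definition clip K y := Num.max (- K) (Num.min y K).
Definition within_ind K y : R := \1_(`[- K, K]%classic) y.

Lemma within_indE K y : within_ind K y = (`|y| <= K)%R%:R.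
Proof.
rewrite /within_ind indicE; congr (nat_of_bool _)%:R.
by rewrite mem_setE in_itv/= ler_norml.
Qed.

Lemma measurable_within_ind K : measurable_fun setT (within_ind K).
Proof. exact: measurable_indic. Qed.

Lemma measurable_clip K : measurable_fun setT (clip K).
Proof. by apply: measurable_maxr => //; exact: measurable_minr. Qed.

Lemma clip_id K y : `|y| <= K -> clip K y = y.
Proof.
rewrite ler_norml => /andP[h1 h2].
by rewrite /clip (min_idPl h2) (max_idPr h1).
Qed.

Lemma clip_le K y : 0 <= K -> `|clip K y| <= K.
Proof.
move=> K0; rewrite ler_norml /clip le_max lexx/=.
by rewrite ge_max ge_min lexx orbT andbT; lra.
Qed.

Lemma clip_gt K y : 0 <= K -> K < `|y| ->
  clip K y ^+ 2 = K ^+ 2 /\ `|y - clip K y| = `|y| - K.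
Proof.
move=> K0; have [y0|y0] := leP 0 y.
  rewrite ger0_norm// => Ky; rewrite /clip (min_idPr (ltW Ky)).
  have -> : Num.max (- K) K = K by apply/max_idPr; lra.
  by rewrite ger0_norm// subr_ge0 ltW.
rewrite ltr0_norm// => Ky; rewrite /clip.
have -> : Num.min y K = y by apply/min_idPl; lra.
have -> : Num.max (- K) y = - K by apply/max_idPl; lra.
by rewrite sqrrN ltr0_norm; lra.
Qed.

End truncation.

Section martingale_transform.
Context d (T : measurableType d) (R : realType) (P : probability T R).
Variables (G : nat -> set (set T)) (M theta : nat -> T -> R).
Hypothesis sG : forall j, sub_algebra (G j).
Hypothesis GS : forall j, G j `<=` G j.+1.
Hypothesis mM : forall j, measurable_wrt (G j) (M j).
Hypothesis LM : forall j, L1 P (M j).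
Hypothesis martM : forall i j A, (i <= j)%N -> G i A ->
  Ex P (fun x => \1_A x * (M j x - M i x)) = 0.
Hypothesis mtheta : forall j, measurable_wrt (G j) (theta j).
Hypothesis theta1 : forall j x, `|theta j x| <= 1.
Variables (K L : R).
Hypotheses (K0 : 0 < K) (L0 : 0 < L).

Lemma mart_ortho i j xi B : (i <= j)%N -> measurable_wrt (G i) xi ->
  (forall x, `|xi x| <= B) -> Ex P (fun x => xi x * (M j x - M i x)) = 0.
Proof.
move=> ij measurable_xi xiB; apply: (Ex_mul_wrt_eq0 (sG i)) measurable_xi xiB; first exact: L1B.
by move=> A GA; exact: martM.
Qed.

(** The indicator that the exit time of [M] from [-K, K] is later than j; as a product of indicators
    it is visibly adapted and decreasing in j. *)
Fixpoint below j x : R :=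
  within_ind K (M j x) * (if j is k.+1 then below k x else 1).

(* Stepping onto [clip K (M k.+1 x)] rather than [M k.+1 x] keeps the transform bounded by
   [L + 2 * K] even though the increments of [M] are not bounded; as long as [M] stays below [K] and
   the transform below [L] nothing is changed. *)
Fixpoint trunc_transform j x : R := if j is k.+1 then
  trunc_transform k x + within_ind L (trunc_transform k x) *
    (below k x * theta k x * (clip K (M k.+1 x) - M k x)) else 0.

Local Notation a := below.
Local Notation S := trunc_transform.

Lemma below01 j x : a j x = 1 \/ a j x = 0.
Proof.
elim: j => [|j ih] /=; rewrite within_indE; case: (_ <= _); rewrite ?mul0r ?mul1r; auto.
Qed.

Lemma belowS j x : a j.+1 x = within_ind K (M j.+1 x) * a j x.
Proof. by []. Qed.

Lemma below_le1 j x : `|a j x| <= 1.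
Proof. by case: (below01 j x) => ->; rewrite ?normr1 ?normr0. Qed.

Lemma below_eq1 j x : a j x = 1 -> `|M j x| <= K.
Proof.
by case: j => [|j] /=; rewrite within_indE; case: (_ <= _) => //=;
  rewrite ?mul0r => /esym/eqP; rewrite oner_eq0.
Qed.

Lemma measurable_below j : measurable_wrt (G j) (a j).
Proof.
elim: j => [|j ih].
  apply/measurable_wrtP => //=; apply: measurable_funM => //.
  apply: measurableT_comp; first exact: measurable_within_ind.
  exact/measurable_wrtP.
apply/measurable_wrtP => //=; apply: measurable_funM => //.
  apply: measurableT_comp; first exact: measurable_within_ind.
  exact/measurable_wrtP.
by apply/measurable_wrtP => //; exact: measurable_wrt_sub ih.
Qed.

Lemma measurable_trunc_transform j : measurable_wrt (G j) (S j).
Proof.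
elim: j => [|j ih].
  by apply/measurable_wrtP => //=; exact: measurable_cst.
have w f : measurable_wrt (G j) f ->
    measurable_fun setT (f : g_sigma_algebraType (G j.+1) -> R).
  by move=> mf; apply/measurable_wrtP => //; exact: measurable_wrt_sub mf.
apply/measurable_wrtP => //=; apply: measurable_funD; first exact: w.
apply: measurable_funM.
  apply: measurableT_comp; first exact: measurable_within_ind.
  exact: w.
apply: measurable_funM.
  by apply: measurable_funM; apply: w => //; exact: measurable_below.
apply: measurable_funB; last exact: w.
apply: measurableT_comp; first exact: measurable_clip.
exact/measurable_wrtP.
Qed.

Lemma below_mul_le j x : `|a j x * M j x| <= K.
Proof.
case: (below01 j x) => ax; rewrite ax; last by rewrite mul0r normr0 ltW.
by rewrite mul1r; exact: below_eq1.
Qed.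

Lemma trunc_transform_le j x : `|S j x| <= L + 2 * K.
Proof.
elim: j => [|j ih] /=; first by rewrite normr0 addr_ge0 ?mulr_ge0// ltW.
rewrite within_indE; have [SL|_] := leP `|S j x| L; last by rewrite mul0r addr0.
rewrite mul1r (le_trans (ler_normD _ _))// lerD//.
rewrite (_ : _ * _ * _ = theta j x * (a j x * clip K (M j.+1 x) - a j x * M j x)); last ring.
rewrite normrM (le_trans (ler_piMl _ (theta1 _ _)))//.
rewrite (le_trans (ler_normB _ _))// mulr_natl mulr2n lerD ?below_mul_le//.
rewrite normrM (le_trans (ler_piMl _ (below_le1 _ _)))//.
exact/clip_le/ltW.
Qed.

(* Lyapunov function dominating [S j ^+ 2]: while [M] stays below [K] its increments are at most
   those of a martingale, and at the exit of [M] the excess is at most [(2 * L + 2 * K) * `|M|],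
   which has bounded expectation; no second moment of [M] is needed. *)
Let U j x := S j x ^+ 2 - a j x * M j x ^+ 2 + K ^+ 2 * a j x.
(** The coefficient of the increment of [M] in the growth of [U]. It is known at time j and bounded
    by L + K, so its contribution has mean zero. *)
Let xi j x := within_ind L (S j x) * theta j x * S j x * a j x - a j x * M j x.

(** While [M] stays inside, its squared increment bounds that of the transform, since |theta| <= 1,
    and cancels against the growth of M^2. At the exit step the term K^2 of [U] pays for the square
    K^2 of the clipped value, and replacing M by its clip costs the overshoot |M| - K times 2 L + 2
    K, where L and K bound the previous values of S and M. *)
Lemma lyapunov_step j x : U j.+1 x <= U j x + 2 * (xi j x * (M j.+1 x - M j x)) +
  (2 * L + 2 * K) * ((a j x - a j.+1 x) * `|M j.+1 x|).
Proof.
rewrite /U /xi belowS /= !within_indE.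
have th := theta1 j x; have th2 : theta j x ^+ 2 <= 1.
  by rewrite -(real_normK (num_real _)) exprn_ile1.
have aM := @below_eq1 j x.
move: (M j.+1 x) (M j x) (S j x) (theta j x) (a j x) (below01 j x) aM th th2.
move=> m' m s t al al01 aM th th2.
have [m'K|Km'] := leP `|m'| K; rewrite /= ?mul0r ?mul1r ?mulr0 ?subrr ?subr0.
  rewrite clip_id// mul0r mulr0 addr0.
  case: al01 => ->; last by rewrite !(mul0r,mulr0); lra.
  have [sL|sL] := leP `|s| L; rewrite /= !(mul0r, mul1r, mulr1, subr0, addr0); last first.
    have := sqr_ge0 (m' - m).
    have -> : 2 * ((0 - m) * (m' - m)) = (m' - m) ^+ 2 + m ^+ 2 - m' ^+ 2 by ring.
    by lra.
  have h : (t * (m' - m)) ^+ 2 <= (m' - m) ^+ 2.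
    by rewrite exprMn ler_piMl// sqr_ge0.
  have -> : (s + t * (m' - m)) ^+ 2 = s ^+ 2 + 2 * s * (t * (m' - m)) + (t * (m' - m)) ^+ 2 by ring.
  have E : 2 * ((t * s - m) * (m' - m)) =
      2 * s * (t * (m' - m)) + (m' - m) ^+ 2 + m ^+ 2 - m' ^+ 2 by ring.
  by rewrite E; move: h; lra.
have [c2 ce] := clip_gt (ltW K0) Km'.
case: al01 => al1; rewrite al1; last by rewrite !(mul0r,mulr0,subrr); lra.
have {}aM := aM al1.
move: c2 ce; set c := clip K m'; move: c => c c2 ce.
have mc : - (m' - c) * m <= `|m' - c| * K.
  by rewrite (le_trans (ler_norm _))// normrM normrN ler_wpM2l.
have LK : 0 <= L * K by exact: mulr_ge0 (ltW L0) (ltW K0).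
have KK : 0 <= K * K by exact: mulr_ge0 (ltW K0) (ltW K0).
have mc2 : m * (m' - c) <= K * `|m' - c|.
  by rewrite (le_trans (ler_norm _))// normrM ler_wpM2r.
have [sL|_] := leP `|s| L; rewrite /= !(mul0r, mul1r, mulr1, subr0, addr0, mulr0).
  have h : t ^+ 2 * (c - m) ^+ 2 <= (c - m) ^+ 2 by rewrite ler_piMl// sqr_ge0.
  have tse : - (t * s * (m' - c)) <= L * `|m' - c|.
    rewrite (le_trans (ler_norm _))// normrN !normrM ler_wpM2r//.
    by rewrite (le_trans (ler_piMl _ th)).
  rewrite ce in tse mc2.
  have -> : (s + t * (c - m)) ^+ 2 = s ^+ 2 + 2 * (t * s * (m' - m)) +
      2 * - (t * s * (m' - c)) + t ^+ 2 * (c - m) ^+ 2 by ring.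
  have -> : 2 * ((t * s - m) * (m' - m)) = 2 * (t * s * (m' - m)) -
      2 * (m * (m' - c)) - 2 * (m * c) + 2 * m ^+ 2 by ring.
  have cmE : (c - m) ^+ 2 = K ^+ 2 - 2 * (m * c) + m ^+ 2 by rewrite -c2; ring.
  move: h; rewrite [leRHS]cmE; set y := t ^+ 2 * _; move: y => y h.
  move: tse; set z := - _; move: z => z tse.
  have -> : (2 * L + 2 * K) * `|m'| = 2 * (L * (`|m'| - K)) + 2 * (K * (`|m'| - K)) +
      2 * (L * K) + 2 * (K * K) by ring.
  by lra.
rewrite ce in mc2.
have : 0 <= (c - m) ^+ 2 by exact: sqr_ge0.
have -> : (c - m) ^+ 2 = K ^+ 2 - 2 * (m * c) + m ^+ 2 by rewrite -c2; ring.
have -> : 2 * ((0 - m) * (m' - m)) = - 2 * (m * (m' - c)) - 2 * (m * c) + 2 * m ^+ 2 by ring.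
have -> : (2 * L + 2 * K) * `|m'| = 2 * (L * (`|m'| - K)) + 2 * (K * (`|m'| - K)) +
    2 * (L * K) + 2 * (K * K) by ring.
have : 0 <= L * (`|m'| - K) by rewrite mulr_ge0 ?subr_ge0 ?ltW.
by move: mc2; nra.
Qed.

(** |M| is a submartingale: with s the sign of [M i], E[z |M i|] = E[z s M i] = E[z s M n] <=
    E[z |M n|], the middle step being the martingale property against the bounded weight z s. *)
Lemma Ex_mul_abs_mart i n (z : T -> R) : (i <= n)%N -> measurable_wrt (G i) z ->
  (forall x, 0 <= z x <= 1) ->
  Ex P (fun x => z x * `|M i x|) <= Ex P (fun x => z x * `|M n x|).
Proof.
move=> ni mz z01.
pose s (y : R) : R := 2 * \1_(`[0, +oo[%classic) y - 1.
have ms : measurable_fun setT s.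
  apply: measurable_funB => //; apply: measurable_funM => //.
have sE y : s y * y = `|y| /\ `|s y| <= 1.
  rewrite /s indicE mem_setE in_itv/= andbT; case: leP => y0 /=.
    by rewrite ger0_norm// mulr1 ger0_norm; lra.
  by rewrite ltr0_norm// mulr0 sub0r normrN1; split; lra.
have mzi : measurable_fun setT z by exact: measurable_wrt_measurable mz.
have z1 x : `|z x| <= 1 by have /andP[? ?] := z01 x; rewrite ger0_norm.
have mzs : measurable_wrt (G i) (fun x => z x * s (M i x)).
  apply/measurable_wrtP => //; apply: measurable_funM; first exact/measurable_wrtP.
  by apply: measurableT_comp => //; exact/measurable_wrtP.
have zs1 x : `|z x * s (M i x)| <= 1.
  by rewrite normrM mulr_ile1//; exact: (sE _).2.
have := mart_ortho ni mzs zs1.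
have -> : (fun x => z x * s (M i x) * (M n x - M i x)) =
    (fun x => z x * s (M i x) * M n x - z x * `|M i x|).
  by apply/funext => x; rewrite mulrBr -(sE (M i x)).1; ring.
have mzs' : measurable_fun setT (fun x => z x * s (M i x)).
  exact: measurable_wrt_measurable mzs.
rewrite ExB => [/eqP| |]; first last.
- by apply: (L1_bounded_mul mzi z1); exact: L1_norm.
- exact: (L1_bounded_mul mzs' zs1).
rewrite subr_eq0 => /eqP <-; apply: Ex_le.
- exact: (L1_bounded_mul mzs' zs1).
- by apply: (L1_bounded_mul mzi z1); exact: L1_norm.
move=> x; rewrite -mulrA ler_wpM2l//; first by case/andP: (z01 x).
by rewrite (le_trans (ler_norm _))// normrM (le_trans (ler_piMl _ (sE _).2)).
Qed.

Lemma measurable_fun_below j : measurable_fun setT (a j).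
Proof. exact: measurable_wrt_measurable (@measurable_below j). Qed.

Lemma L1_below j : L1 P (a j).
Proof. exact: (L1_bounded P (measurable_fun_below j) (below_le1 j)). Qed.

Lemma measurable_below_drop j : measurable_wrt (G j.+1) (fun x => a j x - a j.+1 x).
Proof.
apply/measurable_wrtP => //; apply: measurable_funB.
  apply/measurable_wrtP => //; exact: measurable_wrt_sub (@measurable_below j).
by apply/measurable_wrtP => //; exact: measurable_below.
Qed.

Lemma below_drop01 j x : 0 <= a j x - a j.+1 x <= 1.
Proof.
rewrite belowS within_indE.
case: (`|M j.+1 x| <= K); rewrite /= ?mul1r ?mul0r ?subrr ?subr0 ?lexx ?ler01//.
by case: (below01 j x) => ->; rewrite ?lexx ?ler01.
Qed.

Lemma below_drop_le1 j x : `|a j x - a j.+1 x| <= 1.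
Proof. by have /andP[h1 h2] := below_drop01 j x; rewrite ger0_norm. Qed.

Lemma L1_below_dropM j i : L1 P (fun x => (a j x - a j.+1 x) * `|M i x|).
Proof.
apply: (L1_bounded_mul _ (below_drop_le1 j)); last exact: L1_norm.
by apply: measurable_funB; exact: measurable_fun_below.
Qed.

Lemma L1_belowM j i : L1 P (fun x => a j x * `|M i x|).
Proof. exact: (L1_bounded_mul (measurable_fun_below j) (below_le1 j) (L1_norm (LM i))). Qed.

Lemma L2_trunc_transform j : L2 P (S j).
Proof.
apply: (L2_bounded P _ (trunc_transform_le j)).
exact: measurable_wrt_measurable (measurable_trunc_transform j).
Qed.

Lemma below_mul_sqr j x : 0 <= a j x * M j x ^+ 2 <= K ^+ 2 * a j x.
Proof.
have := @below_eq1 j x; case: (below01 j x) => -> h; last by rewrite !mul0r mulr0 lexx.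
rewrite mul1r mulr1 sqr_ge0/= -(real_normK (num_real _)).
by rewrite lerXn2r ?nnegrE ?(ltW K0)//; exact: h.
Qed.

Lemma L1_lyapunov j : L1 P (U j).
Proof.
apply: L1D; last by apply: L1Z; exact: L1_below.
apply: L1B; first exact: (L2_trunc_transform j).2.
apply: (@L1_bounded _ _ _ _ _ (K ^+ 2)).
  apply: measurable_funM; first exact: measurable_fun_below.
  by apply: measurable_funX; exact: L1_measurable (LM j).
move=> x; have /andP[h1 h2] := below_mul_sqr j x; rewrite ger0_norm// (le_trans h2)//.
by case: (below01 j x) => ->; rewrite ?mulr1 ?mulr0 ?sqr_ge0.
Qed.

Lemma measurable_xi j : measurable_wrt (G j) (xi j).
Proof.
have w f : measurable_wrt (G j) f ->
    measurable_fun setT (f : g_sigma_algebraType (G j) -> R).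
  by move=> mf; apply/measurable_wrtP.
apply/measurable_wrtP => //; apply: measurable_funB; last first.
  by apply: measurable_funM; apply: w => //; exact: measurable_below.
apply: measurable_funM; last by apply: w; exact: measurable_below.
apply: measurable_funM; last by apply: w; exact: measurable_trunc_transform.
apply: measurable_funM; last exact: w.
apply: measurableT_comp; first exact: measurable_within_ind.
by apply: w; exact: measurable_trunc_transform.
Qed.

Lemma xi_le j x : `|xi j x| <= L + K.
Proof.
rewrite (le_trans (ler_normB _ _))// lerD ?below_mul_le// within_indE.
have [sL|_] := leP `|S j x| L; last by rewrite !mul0r normr0 ltW.
rewrite mul1r !normrM.
rewrite -mulrA (le_trans (ler_piMl _ (theta1 _ _))) ?mulr_ge0//.
by rewrite (le_trans (ler_piMr _ (below_le1 _ _))).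
Qed.

Let C n := Ex P (fun x => `|M n x|).

(** The terms with [xi] vanish in mean. The exit terms, which live at different times, are moved to
    the common time n by [Ex_mul_abs_mart], and there they telescope to (1 - a j) |M n|. *)
Lemma Ex_lyapunov_le n j : (j <= n)%N -> Ex P (U j) <= K ^+ 2 +
  (2 * L + 2 * K) * Ex P (fun x => (1 - a j x) * `|M n x|).
Proof.
have L1b i : L1 P (fun x => (1 - a i x) * `|M n x|).
  under eq_fun do rewrite mulrBl mul1r.
  by apply: L1B; [exact: L1_norm|exact: L1_belowM].
elim: j => [_|j ih jn].
  apply: (@le_trans _ _ (K ^+ 2)).
    rewrite -[leRHS](Ex_cst P); apply: Ex_le; [exact: L1_lyapunov|exact: (L1_cst P)|].
    move=> x; rewrite /U/= expr0n/= mulr1 add0r.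
    have /andP[h _] := below_mul_sqr 0 x; move: h => /=; rewrite mulr1.
    have : within_ind K (M 0 x) <= 1.
      by rewrite within_indE; case: (`|M 0 x| <= K); rewrite ?lexx ?ler01.
    have := sqr_ge0 K; nra.
  rewrite lerDl mulr_ge0//; first by rewrite addr_ge0// mulr_ge0// ltW.
  apply: Ex_ge0 => x; rewrite mulr_ge0//.
  by case: (below01 0 x) => ->; rewrite ?subrr ?subr0.
have L1x : L1 P (fun x => xi j x * (M j.+1 x - M j x)).
  apply: (L1_bounded_mul _ (xi_le j)); last exact: L1B.
  exact: measurable_wrt_measurable (measurable_xi j).
apply: (@le_trans _ _ (Ex P (fun x => U j x + 2 * (xi j x * (M j.+1 x - M j x)) +
  (2 * L + 2 * K) * ((a j x - a j.+1 x) * `|M j.+1 x|)))).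
  apply: Ex_le; [exact: L1_lyapunov| |by move=> x; exact: lyapunov_step].
  by apply: L1D; [apply: L1D; [exact: L1_lyapunov|exact: L1Z]|exact/L1Z/L1_below_dropM].
rewrite ExD; [|by apply: L1D; [exact: L1_lyapunov|exact: L1Z]|exact/L1Z/L1_below_dropM].
rewrite ExD; [|exact: L1_lyapunov|exact: L1Z].
rewrite ExZ// ExZ; last exact: L1_below_dropM.
rewrite (mart_ortho (leqnSn j) (measurable_xi j) (xi_le j)) mulr0 addr0.
apply: (le_trans (lerD (ih (ltnW jn)) (lexx _))).
rewrite -addrA lerD2l -mulrDr ler_wpM2l//.
  by rewrite addr_ge0// mulr_ge0// ltW.
apply: (le_trans (lerD (lexx _) (Ex_mul_abs_mart jn (measurable_below_drop j) (below_drop01 j)))).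
rewrite -ExD; [|exact: L1b|exact: L1_below_dropM].
apply: Ex_le; [by apply: L1D; [exact: L1b|exact: L1_below_dropM]|exact: L1b|].
by move=> x; rewrite -mulrDl ler_wpM2r//; lra.
Qed.

(** Doob's maximal inequality: |M| > K at the exit step, and the submartingale property carries each
    exit event to time n. *)
Lemma Ex_below n j : (j <= n)%N ->
  K * Ex P (fun x => 1 - a j x) <= Ex P (fun x => (1 - a j x) * `|M n x|).
Proof.
have L1b i k : L1 P (fun x => (1 - a i x) * `|M k x|).
  under eq_fun do rewrite mulrBl mul1r.
  by apply: L1B; [exact: L1_norm|exact: L1_belowM].
have L1c i : L1 P (fun x => 1 - a i x) by apply: L1B; [exact: (L1_cst P)|exact: L1_below].
elim: j => [_|j ih jn].
  rewrite -ExZ//.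
  apply: (@le_trans _ _ (Ex P (fun x => (1 - a 0 x) * `|M 0 x|))).
    apply: Ex_le => //; first exact: L1Z.
    move=> x /=; rewrite within_indE mulr1; have [h|h] := leP `|M 0 x| K.
      by rewrite subrr mul0r mulr0.
    by rewrite subr0 mul1r mulr1 ltW.
  apply: Ex_mul_abs_mart => //.
    apply/measurable_wrtP => //; apply: measurable_funB => //.
    by apply/measurable_wrtP => //; exact: measurable_below.
  by move=> x; case: (below01 0 x) => ->; rewrite ?subrr ?subr0 ?lexx ?ler01.
have E : (fun x => 1 - a j.+1 x) = (fun x => (1 - a j x) + (a j x - a j.+1 x)).
  by apply/funext => x; ring.
have L1d : L1 P (fun x => a j x - a j.+1 x) by apply: L1B; exact: L1_below.
rewrite E ExD// mulrDr.
have E' : (fun x => (1 - a j.+1 x) * `|M n x|) =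
   (fun x => (1 - a j x) * `|M n x| + (a j x - a j.+1 x) * `|M n x|).
  by apply/funext => x; ring.
rewrite E' [leRHS]ExD; [|exact: L1b|exact: L1_below_dropM].
rewrite lerD ?ih 1?ltnW//.
apply: (le_trans _ (Ex_mul_abs_mart jn (measurable_below_drop j) (below_drop01 j))).
rewrite -ExZ//; apply: Ex_le; [exact: L1Z|exact: L1_below_dropM|].
move=> x; rewrite belowS within_indE; have [h|h] := leP `|M j.+1 x| K.
  by rewrite mul1r subrr mulr0 mul0r.
rewrite mul0r subr0 mulrC ler_wpM2l//; last exact: ltW.
by case: (below01 j x) => ->; rewrite ?ler01.
Qed.

(** If [M] never left [-K, K] and the truncated transform ends in [-L, L], no truncation has acted
    and it equals the true transform. The two summands come from Doob's inequality and from
    Chebyshev's inequality for the truncated transform; only a first moment of [M n] enters. *)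
Lemma martingale_transform_weak n :
  fine (P [set x | L < `|\sum_(j < n) theta j x * (M j.+1 x - M j x)|]) <=
  C n / K + (K ^+ 2 + (2 * L + 2 * K) * C n) / L ^+ 2.
Proof.
set A := [set x | _].
pose B := [set x | L < `|S n x|].
have mgt (f : T -> R) : measurable_fun setT f -> measurable [set x | L < `|f x|].
  by move=> mf; apply: measurable_gt; apply: measurableT_comp.
have mB : measurable B by apply: mgt; exact: (L2_trunc_transform n).1.
have mA : measurable A.
  apply: mgt; apply: measurable_sum => j; apply: measurable_funM.
    exact: measurable_wrt_measurable (mtheta j).
  by apply: measurable_funB; exact: L1_measurable.
have ST j x : a j x = 1 -> `|S j x| <= L ->
    S j x = \sum_(k < j) theta k x * (M k.+1 x - M k x).
  elim: j => [|j ih]; first by rewrite big_ord0.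
  rewrite belowS !within_indE big_ord_recr/=.
  have [MK|_] := leP `|M j.+1 x| K; last by rewrite mul0r => /esym/eqP; rewrite oner_eq0.
  rewrite mul1r => a1; rewrite a1 clip_id// !mul1r within_indE.
  have [SL|SL] /= := leP `|S j x| L; first by rewrite mul1r ih.
  by rewrite mul0r addr0 leNgt SL.
have L1c i : L1 P (fun x => 1 - a i x) by apply: L1B; [exact: (L1_cst P)|exact: L1_below].
rewrite -Ex_indic//.
apply: (@le_trans _ _ (Ex P (fun x => (1 - a n x) + \1_B x))).
  apply: Ex_le; [exact: L1_indic|by apply: L1D => //; exact: L1_indic|] => x.
  rewrite !indicE; have [/set_mem Ax|_] := boolP (x \in A); last first.
    by rewrite addr_ge0//; case: (below01 n x) => ->; rewrite ?subrr ?subr0.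
  have [|/negP Bx] := boolP (x \in B).
    by rewrite lerDr; case: (below01 n x) => ->; rewrite ?subrr ?subr0.
  case: (below01 n x) => an; last by rewrite an subr0 addr0.
  exfalso; move: Ax; rewrite /A/= -ST//; first by move=> h; apply: Bx; rewrite inE.
  by rewrite leNgt; apply/negP => h; apply: Bx; rewrite inE.
have c0 : 0 <= 2 * L + 2 * K by rewrite addr_ge0// mulr_ge0// ltW.
have L1b i k : L1 P (fun x => (1 - a i x) * `|M k x|).
  under eq_fun do rewrite mulrBl mul1r.
  by apply: L1B; [exact: L1_norm|exact: L1_belowM].
have bC : Ex P (fun x => (1 - a n x) * `|M n x|) <= C n.
  apply: Ex_le => //; first exact: L1_norm.
  by move=> x; rewrite ler_piMl//; case: (below01 n x) => ->; rewrite ?subrr ?subr0.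
rewrite ExD//; last exact: L1_indic.
rewrite lerD//.
  by rewrite ler_pdivlMr// mulrC (le_trans (Ex_below (leqnn n))).
rewrite Ex_indic// (le_trans (chebyshev_Ex (L2_trunc_transform n) L0))//.
rewrite ler_wpM2r ?invr_ge0 ?sqr_ge0//.
apply: (@le_trans _ _ (Ex P (U n))).
  apply: Ex_le; [exact: (L2_trunc_transform n).2|exact: L1_lyapunov|].
  by move=> x; rewrite /U; have /andP[_] := below_mul_sqr n x; lra.
apply: (le_trans (Ex_lyapunov_le (leqnn n))).
by rewrite lerD2l ler_wpM2l.
Qed.

End martingale_transform.

(** * Tightness of semimartingale transforms *)

Section bounded_variation_grid.
Context {R : realType}.

(** Jordan decomposition: f = g - h with g and h nondecreasing, so the sum is at most the total
    growth of g and h over [0, 1], whatever the grid. *)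
Lemma bounded_variation_grid (f : R -> R) : bounded_variation 0 1 f ->
  exists B, forall (t : nat -> R) n, (forall j, 0 <= t j <= 1) ->
    (forall j, t j <= t j.+1) -> \sum_(j < n) `|f (t j.+1) - f (t j)| <= B.
Proof.
move=> bf; have bfN : bounded_variation 0 1 (\- f) by exact: bounded_variationN.
have fE := bounded_variation_pos_neg_tvE bf.
have gm := fine_neg_tv_nondecreasing bfN.
have hm := fine_neg_tv_nondecreasing bf.
set h := fine \o neg_tv 0 f in fE hm.
set g := fine \o pos_tv 0 f in fE.
(* [pos_tv 0 f] is by definition [neg_tv 0] of -f, so this holds by conversion. *)
have {}gm : {in `[0, 1] &, nondecreasing_fun g} by [].
exists (g 1 - g 0 + (h 1 - h 0)) => t n t01 tm.
have tI j : t j \in `[0, 1]%R by rewrite in_itv/=.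
have I0 : (0 : R) \in `[0, 1]%R by rewrite in_itv/= lexx ler01.
have I1 : (1 : R) \in `[0, 1]%R by rewrite in_itv/= lexx ler01.
apply: (@le_trans _ _ (g (t n) - g (t 0) + (h (t n) - h (t 0)))).
  elim: n => [|n ih]; first by rewrite big_ord0 !subrr addr0.
  rewrite big_ord_recr/= (le_trans (lerD ih (lexx _)))// !fE//=.
  have h1 := gm _ _ (tI n) (tI n.+1) (tm n).
  have h2 := hm _ _ (tI n) (tI n.+1) (tm n).
  suff : `|g (t n.+1) - h (t n.+1) - (g (t n) - h (t n))| <=
    (g (t n.+1) - g (t n)) + (h (t n.+1) - h (t n)) by lra.
  by rewrite ler_norml; apply/andP; split; lra.
have /andP[n0 n1] := t01 n; have /andP[z0 z1] := t01 0%N.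
have := gm _ _ (tI n) I1 n1; have := hm _ _ (tI n) I1 n1.
have := gm _ _ I0 (tI 0%N) z0; have := hm _ _ I0 (tI 0%N) z0.
by lra.
Qed.

End bounded_variation_grid.

(** [K] is chosen first, for C / K <= eta / 2; with [K] fixed the remaining term is O(1 / L). *)
Lemma weak_bound_small (R : realType) (C eta : R) : 0 <= C -> 0 < eta ->
  exists K L, [/\ 0 < K, 0 < L &
  C / K + (K ^+ 2 + (2 * L + 2 * K) * C) / L ^+ 2 <= eta].
Proof.
move=> C0 eta0; pose K := 2 * C / eta + 1.
have K0 : 0 < K by rewrite ltr_pwDr// divr_ge0 ?mulr_ge0// ltW.
pose q := K ^+ 2 + 2 * K * C + 2 * C.
have q0 : 0 <= q by rewrite !addr_ge0 ?mulr_ge0 ?sqr_ge0// ltW.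
(* Since L >= 1, the numerator is at most q L; this L then makes q / L <= eta / 2. *)
pose L := 2 * q / eta + 1.
have L1 : 1 <= L by rewrite lerDr divr_ge0 ?mulr_ge0// ltW.
have L0 : 0 < L by exact: lt_le_trans L1.
exists K, L; split => //.
have CK : C / K <= eta / 2.
  rewrite ler_pdivrMr// /K mulrDr mulr1.
  have -> : eta / 2 * (2 * C / eta) = C by field; rewrite gt_eqF.
  by rewrite lerDl divr_ge0// ltW.
suff : (K ^+ 2 + (2 * L + 2 * K) * C) / L ^+ 2 <= eta / 2 by lra.
rewrite ler_pdivrMr ?exprn_gt0//.
apply: (@le_trans _ _ (q * L)).
  have -> : K ^+ 2 + (2 * L + 2 * K) * C = (K ^+ 2 + 2 * K * C) * 1 + 2 * C * L by ring.
  have -> : q * L = (K ^+ 2 + 2 * K * C) * L + 2 * C * L by rewrite /q; ring.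
  rewrite lerD2r ler_wpM2l//.
  by rewrite addr_ge0 ?mulr_ge0 ?sqr_ge0// ltW.
rewrite expr2 mulrA ler_wpM2r ?(ltW L0)// /L mulrDr mulr1.
have -> : eta / 2 * (2 * q / eta) = q by field; rewrite gt_eqF.
by rewrite lerDl divr_ge0// ltW.
Qed.

Section tightness.
Context d (T : measurableType d) (R : realType) (P : probability T R).

Lemma fine_prob_le (A B : set T) : measurable A -> measurable B -> A `<=` B ->
  fine (P A) <= fine (P B).
Proof.
move=> mA mB AB; rewrite fine_le ?fin_num_measure// le_measure// inE//.
Qed.

Lemma fine_probU (A B : set T) : measurable A -> measurable B ->
  fine (P (A `|` B)) <= fine (P A) + fine (P B).
Proof.
move=> mA mB; rewrite -fineD ?fin_num_measure// fine_le ?fin_numD ?fin_num_measure//.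
  exact: measurableU.
exact: measureU2.
Qed.

(** The union over n of these events decreases in k to a null set, so continuity from above gives
    one k for all n. *)
Lemma tight_of_ae_bounded (Z : nat -> T -> R) :
  (forall n, measurable_fun setT (Z n)) ->
  {ae P, forall w, exists B, forall n, Z n w <= B} ->
  forall eta, 0 < eta -> exists k : nat, forall n,
    fine (P [set w | k%:R < Z n w]) <= eta.
Proof.
move=> mZ [N [mN PN0 subN]] eta eta0.
pose E (k : nat) := \bigcup_n [set w | k%:R < Z n w].
have mE k : measurable (E k) by apply: bigcup_measurable => n _; exact: measurable_gt.
have Ecap : \bigcap_k E k `<=` N.
  move=> w Ew; apply: subN => /= -[B ZB].
  have [n _ /=] := Ew (Num.truncn `|B|).+1 I.
  apply/negP; rewrite -leNgt (le_trans (ZB n))// (le_trans (ler_norm _))//.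
  exact/ltW/truncnS_gt.
have cE : P \o E @ \oo --> P (\bigcap_k E k).
  apply: nonincreasing_cvg_mu => //.
  - by rewrite (le_lt_trans (probability_le1 P (mE 0%N)))// ltry.
  - exact: bigcap_measurable.
  - move=> m n mn; apply/subsetPset => w [i _ /= h]; exists i => //=.
    by apply: le_lt_trans h; rewrite ler_nat.
have cap0 : P (\bigcap_k E k) = 0%E.
  apply/eqP; rewrite -measure_le0 -PN0; apply: le_measure => //; rewrite inE//.
  exact: bigcap_measurable.
rewrite cap0 in cE.
have O : nbhs (0%E : \bar R) [set x | (x < eta%:E)%E].
  apply: open_nbhs_nbhs; split; first exact: open_ereal_lt_ereal.
  by rewrite /= lte_fin.
have [k _ Ek] := cE _ O.
exists k => n; apply: (@le_trans _ _ (fine (P (E k)))).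
  apply: fine_prob_le => //; first exact: measurable_gt.
  by move=> w h; exists n.
by apply/ltW; rewrite -lte_fin fineK ?fin_num_measure//; exact: (Ek k (leqnn k)).
Qed.

End tightness.

Section semimartingale_tight.
Context d (T : measurableType d) (R : realType) (P : probability T R).
Variables (F : R -> set (set T)) (t : nat -> nat -> R) (theta : nat -> nat -> T -> R).
Hypothesis filF : filtration F.
Hypothesis t01 : forall n j, 0 <= t n j <= 1.
Hypothesis tm : forall n j, t n j <= t n j.+1.
Hypothesis mtheta : forall n j, measurable_wrt (F (t n j)) (theta n j).
Hypothesis theta1 : forall n j x, `|theta n j x| <= 1.

Lemma filtration_sub_algebra s : 0 <= s <= 1 -> sub_algebra (F s).
Proof. by move=> s01; exact: filF.1. Qed.

(** The weak-type bound sees the grid only through a first moment of [N], which the submartingale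
    property bounds by the one at time 1; hence [K] does not depend on n. *)
Lemma martingale_tight (N : R -> T -> R) : martingale P F N ->
  forall eta, 0 < eta -> exists2 K, 0 < K & forall n,
    fine (P [set w | K < `|\sum_(j < n) theta n j w * (N (t n j.+1) w - N (t n j) w)|]) <= eta.
Proof.
move=> [adN [intN mart]] eta eta0.
pose C := Ex P (fun w => `|N 1 w|).
have C0 : 0 <= C by exact: Ex_ge0.
have [K [L [K0 L0 KL]]] := weak_bound_small C0 eta0.
exists L => // n.
(* The grid is continued by the time 1, so that [C] bounds all first moments along it. *)
pose s j := if (j <= n)%N then t n j else 1.
have s01 j : 0 <= s j <= 1 by rewrite /s; case: ifP; rewrite ?t01// ler01 lexx.
have sm j : s j <= s j.+1.
  rewrite /s; case: (ltnP j n) => jn; first by rewrite (ltnW jn).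
  by case: ifP => _; [case/andP: (t01 n j)|].
have smono i j : (i <= j)%N -> s i <= s j.
  move/subnK => <-; elim: (j - i)%N => [|k ih]//.
  by rewrite (le_trans ih)// addSn.
have sG j : sub_algebra (F (s j)) by exact: filtration_sub_algebra.
have GS j : F (s j) `<=` F (s j.+1).
  have /andP[h0 _] := s01 j; have /andP[_ h1] := s01 j.+1.
  exact: filF.2.
have mM j : measurable_wrt (F (s j)) (N (s j)) by apply: adN.
have LM j : L1 P (N (s j)) by apply: intN.
have martM i j A : (i <= j)%N -> F (s i) A ->
    Ex P (fun x => \1_A x * (N (s j) x - N (s i) x)) = 0.
  move=> ij FA; have mA : measurable A by apply: (sG i).2.
  have Li k : L1 P (fun x => \1_A x * N (s k) x).
    exact: (L1_bounded_mul _ (indic_norm_le1 R A)).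
  have -> : (fun x => \1_A x * (N (s j) x - N (s i) x)) =
      (fun x => \1_A x * N (s j) x - \1_A x * N (s i) x).
    by apply/funext => x; rewrite mulrBr.
  rewrite ExB// !Ex_indicM//.
  have /andP[h0 _] := s01 i; have /andP[_ h1] := s01 j.
  by rewrite (mart (s i) (s j) h0 (smono _ _ ij) h1 A FA) subrr.
pose th j : T -> R := if (j < n)%N then theta n j else cst 0.
have mth j : measurable_wrt (F (s j)) (th j).
  rewrite /th; case: (ltnP j n) => jn.
    by rewrite /s (ltnW jn); exact: mtheta.
  by apply/measurable_wrtP => //; exact: measurable_cst.
have th1 j x : `|th j x| <= 1.
  by rewrite /th; case: ifP => _; [exact: theta1|rewrite /cst normr0 ler01].
have := martingale_transform_weak sG GS mM LM martM mth th1 K0 L0 n.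
have -> : [set x | L < `|\sum_(j < n) th j x * (N (s j.+1) x - N (s j) x)|] =
    [set w | L < `|\sum_(j < n) theta n j w * (N (t n j.+1) w - N (t n j) w)|].
  apply/seteqP; split => x /=; (set u := \sum_(j < n) _; set v := \sum_(j < n) _;
  have -> : u = v by apply: eq_bigr => j _; rewrite /th /s !ltn_ord (ltnW (ltn_ord j))) => //.
move=> /le_trans; apply; apply: le_trans KL.
have Cn : Ex P (fun x => `|N (s n) x|) <= C.
  have mz : measurable_wrt (F (s n)) (fun _ : T => 1 : R).
    by apply/measurable_wrtP => //; exact: measurable_cst.
  have := Ex_mul_abs_mart sG mM LM martM (leqnSn n) mz.
  have -> : (fun x => 1 * `|N (s n.+1) x|) = (fun x => `|N 1 x|).
    by apply/funext => x; rewrite mul1r /s ltnn.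
  have -> : (fun x => 1 * `|N (s n) x|) = (fun x => `|N (s n) x|).
    by apply/funext => x; rewrite mul1r.
  by apply => _; rewrite ler01 lexx.
apply: lerD; first by rewrite ler_wpM2r// invr_ge0 ltW.
rewrite ler_wpM2r ?invr_ge0 ?sqr_ge0// lerD2l ler_wpM2l//.
by rewrite addr_ge0// mulr_ge0// ltW.
Qed.

Lemma stopping_time_lt1_measurable (tau : T -> \bar R) : stopping_time F tau ->
  measurable [set w | (tau w < 1%:E)%E].
Proof.
move=> [tau0 Ftau].
have -> : [set w | (tau w < 1%:E)%E] =
    \bigcup_k [set w | (tau w <= (1 - k.+1%:R^-1)%:E)%E].
  apply/seteqP; split => w /=.
    have := tau0 w; case E: (tau w) => [r| |]//.
    rewrite lte_fin => _ r1.
    have [k rk] := ltr_add_invr r1.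
    by exists k => //=; rewrite E lee_fin lerBrDr ltW.
  move=> [k _ /= h]; apply: (le_lt_trans h).
  by rewrite lte_fin ltrBlDr ltrDl invr_gt0.
apply: bigcup_measurable => k _.
pose r : R := k.+1%:R^-1.
have r1 : r <= 1 by rewrite /r invf_le1// ler1n.
have r0 : 0 <= r by rewrite /r invr_ge0.
have k01 : 0 <= 1 - r <= 1 by apply/andP; split; lra.
by apply: (filF.1 _ k01).2; exact: Ftau.
Qed.

(** Off a null set and the event [tau m] < 1, the increments of X are those of the stopped
    martingale plus those of A. Early stopping, a large martingale transform and a large variation
    of A get eta / 3 each. *)
Lemma semimartingale_tight (X : R -> T -> R) : semimartingale P F X ->
  forall eta, 0 < eta -> exists2 K, 0 < K & forall n,
    fine (P [set w | K < `|\sum_(j < n) theta n j w * (X (t n j.+1) w - X (t n j) w)|]) <= eta.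
Proof.
move=> [adX [M [A [[tau [st_tau [tau_mono [tau_ae mart]]]] [adA ae_dec]]]]] eta eta0.
have e0 : 0 < eta / 3 by rewrite divr_gt0.
have mF s (f : T -> R) : 0 <= s <= 1 -> measurable_wrt (F s) f -> measurable_fun setT f.
  by move=> s01; apply: measurable_wrt_measurable; exact: filtration_sub_algebra.
have mA s : 0 <= s <= 1 -> measurable_fun setT (A s).
  by move=> s01; apply: (mF _ _ s01) => B mB; exact: adA.
have mX s : 0 <= s <= 1 -> measurable_fun setT (X s).
  by move=> s01; apply: (mF _ _ s01) => B mB; exact: adX.
pose D m := [set w | (tau m w < 1%:E)%E].
have mD m : measurable (D m) by exact: stopping_time_lt1_measurable.
have [m Pm] : exists m, fine (P (D m)) <= eta / 3.
  (* Counting the k with [tau k] < 1 turns localization into an almost everywhere bounded sequence;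
     as the [D k] decrease, [Z k.+1] equals k + 1 on all of [D k]. *)
  pose Z n w : R := \sum_(k < n) \1_(D k) w.
  have mZ n : measurable_fun setT (Z n).
    by apply: measurable_sum => k; exact: measurable_indic.
  have Zb : {ae P, forall w, exists B, forall n, Z n w <= B}.
    apply: filterS tau_ae => w [k tk]; exists k%:R => n.
    have tk' j : (k <= j)%N -> (1%:E <= tau j w)%E.
      by move/subnK => <-; elim: (j - k)%N => [|i ih]//; rewrite addSn (le_trans ih).
    rewrite /Z; elim: n => [|n ih]; first by rewrite big_ord0.
    have [nk|kn] := leqP n.+1 k.
      apply: (@le_trans _ _ (\sum_(i < n.+1) (1 : R))).
        by apply: ler_sum => i _; rewrite indicE; case: (_ \in _).
      by rewrite sumr_const card_ord ler_nat.
    rewrite big_ord_recr/= indicE memNset ?addr0//= /D/=.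
    by apply/negP; rewrite -leNgt tk'.
  have [k Pk] := tight_of_ae_bounded mZ Zb e0; exists k.
  apply: le_trans (Pk k.+1); apply: fine_prob_le => //; first exact: measurable_gt.
  move=> w /= Dk; rewrite /Z.
  have -> : \sum_(i < k.+1) \1_(D i) w = \sum_(i < k.+1) (1 : R).
    apply: eq_bigr => i _; rewrite indicE mem_set//= /D/=.
    apply: le_lt_trans Dk.
    have tmono a b : (a <= b)%N -> (tau a w <= tau b w)%E.
      by move/subnK => <-; elim: (b - a)%N => [|l ih]//; rewrite addSn (le_trans ih).
    by apply: tmono; rewrite -ltnS.
  by rewrite sumr_const card_ord ltr_nat.
pose N := stopped (tau m) M.
have [K1 K10 PK1] := martingale_tight (mart m) e0.
pose Z n w : R := \sum_(j < n) `|A (t n j.+1) w - A (t n j) w|.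
have mZ n : measurable_fun setT (Z n).
  apply: measurable_sum => j; apply: measurableT_comp => //.
  by apply: measurable_funB; exact: mA.
have Zb : {ae P, forall w, exists B, forall n, Z n w <= B}.
  apply: filterS ae_dec => w [_ [_ [bA _]]].
  by have [B bB] := bounded_variation_grid bA; exists B => n; exact: bB.
have [k Pk] := tight_of_ae_bounded mZ Zb e0.
exists (K1 + k%:R); first by rewrite ltr_pwDl.
move=> n; have [E [mE PE0 subE]] := ae_dec.
set S := [set w | _].
pose SN := [set w | K1 < `|\sum_(j < n) theta n j w * (N (t n j.+1) w - N (t n j) w)|].
pose SZ := [set w | k%:R < Z n w].
have mN s : 0 <= s <= 1 -> measurable_fun setT (N s).
  by move=> s01; apply: (mF _ _ s01) => B mB; exact: (mart m).1.
have mth j : measurable_fun setT (theta n j).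
  exact: mF (t01 n j) (mtheta n j).
have mS : measurable S.
  apply: measurable_gt; apply: measurableT_comp => //.
  apply: measurable_sum => j; apply: measurable_funM => //.
  by apply: measurable_funB; exact: mX.
have mSN : measurable SN.
  apply: measurable_gt; apply: measurableT_comp => //.
  apply: measurable_sum => j; apply: measurable_funM => //.
  by apply: measurable_funB; exact: mN.
have mSZ : measurable SZ by exact: measurable_gt.
have sub : S `<=` (SN `|` SZ) `|` (D m `|` E).
  move=> w Sw; have [Ew|Ew] := pselect (E w); first by right; right.
  have [Dw|Dw] := pselect (D m w); first by right; left.
  have [ZZ|ZZ] := pselect (SZ w); first by left; right.
  left; left; rewrite /SN/=.
  have {Ew} [_ [_ [_ [_ [_ XE]]]]] : (fun w => cadlag (fun t => M t w) /\ cadlag (fun t => A t w) /\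
      bounded_variation 0 1 (fun t => A t w) /\
      M 0 w = 0 /\ A 0 w = 0 /\
      (forall t, 0 <= t <= 1 -> X t w = X 0 w + M t w + A t w)) w.
    by apply: contrapT => h; apply: Ew; exact: subE.
  have NM j : N (t n j) w = M (t n j) w.
    rewrite /N /stopped; case: ifP => // h; exfalso; apply: Dw; rewrite /D/=.
    by apply: (lt_le_trans h); rewrite lee_fin; case/andP: (t01 n j).
  have -> : \sum_(j < n) theta n j w * (N (t n j.+1) w - N (t n j) w) =
    \sum_(j < n) theta n j w * (X (t n j.+1) w - X (t n j) w) -
    \sum_(j < n) theta n j w * (A (t n j.+1) w - A (t n j) w).
    rewrite -sumrB; apply: eq_bigr => j _.
    by rewrite !NM (XE _ (t01 n j.+1)) (XE _ (t01 n j)); ring.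
  have hA : `|\sum_(j < n) theta n j w * (A (t n j.+1) w - A (t n j) w)| <= Z n w.
    rewrite (le_trans (ler_norm_sum _ _ _))//; apply: ler_sum => j _.
    by rewrite normrM ler_piMl.
  move: Sw ZZ; rewrite /S /SZ/= => Sw /negP; rewrite -leNgt => ZZ.
  have := lerB_dist (\sum_(j < n) theta n j w * (X (t n j.+1) w - X (t n j) w))
    (\sum_(j < n) theta n j w * (A (t n j.+1) w - A (t n j) w)).
  by lra.
apply: (le_trans (fine_prob_le P mS _ sub)).
  by apply: measurableU; exact: measurableU.
apply: (le_trans (fine_probU P _ _)); [exact: measurableU|exact: measurableU|].
have h1 := fine_probU P mSN mSZ.
have h2 := fine_probU P (mD m) mE.
have : fine (P E) = 0 by rewrite PE0.
by have := PK1 n; have := Pk n; rewrite -/SN -/SZ; lra.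
Qed.

End semimartingale_tight.

(** * Gaussian variables and linear combinations of fractional Brownian motion *)

Section standard_normal.
Context {R : realType}.
Local Notation mu := (@lebesgue_measure R).
Definition std_normal : probability (measurableTypeR R) R := normal_prob 0 1.

(** Change of variables through the Radon-Nikodym derivative, which agrees almost everywhere with
    the density. *)
Lemma ge0_integral_std_normal (f : R -> \bar R) : measurable_fun setT f ->
  (forall x, 0 <= f x)%E ->
  (\int[std_normal]_x f x = \int[mu]_x (f x * (normal_pdf 0 1 x)%:E))%E.
Proof.
move=> mf f0.
have dom : std_normal `<< mu by exact: normal_prob_dominates.
rewrite -(Radon_Nikodym_SigmaFinite.change_of_variables dom f0 measurableT)//.
have ig := Radon_Nikodym_SigmaFinite.f_integrable dom.
have mp : measurable_fun setT (fun x : R => (normal_pdf 0 1 x)%:E).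
  by apply/measurable_EFinP; exact: measurable_normal_pdf.
apply: ae_eq_integral => //.
- by apply: emeasurable_funM => //; exact: measurable_int ig.
- by apply: emeasurable_funM.
- apply: ae_eqe_mul2l => /=.
  apply: integral_ae_eq => // E _ mE.
  by rewrite -Radon_Nikodym_SigmaFinite.f_integral.
Qed.

(** From y <= exp(y) at y = x^2 / 4. The right side is a multiple of the density of variance 2,
    whose integral is known, so the second moment is finite without integrating by parts. *)
Lemma std_normal_sqr_pdf_le (x : R) :
  x ^+ 2 * normal_pdf 0 1 x <=
  4 * normal_peak 1 / normal_peak (Num.sqrt 2) * normal_pdf 0 (Num.sqrt 2) x.
Proof.
have p2 : normal_peak (Num.sqrt 2) != 0 :> R by rewrite gt_eqF// normal_peak_gt0.
rewrite normal_pdfE ?oner_eq0// normal_pdfE//.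
rewrite [leRHS](_ : _ = normal_peak 1 * (4 * normal_fun 0 (Num.sqrt 2) x)); last first.
  by field.
rewrite mulrCA ler_wpM2l ?normal_peak_ge0//.
rewrite /normal_fun subr0 sqr_sqrtr// expr1n.
have -> : - x ^+ 2 / 2 = - (x ^+ 2 / 4) + - (x ^+ 2 / 4) by field.
have -> : - x ^+ 2 / (2 *+ 2) = - (x ^+ 2 / 4) by field.
rewrite expRD mulrA ler_wpM2r ?expR_ge0// expRN ler_pdivrMr ?expR_gt0//.
have := expR_ge1Dx (x ^+ 2 / 4); have := expR_ge0 (x ^+ 2 / 4); lra.
Qed.

Lemma std_normal_L2 : L2 std_normal (fun x => x).
Proof.
split=> //; apply/integrableP; split.
  by apply/measurable_EFinP; exact: measurable_funX.
have mx : measurable_fun setT (fun x : R => (x ^+ 2)%:E).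
  by apply/measurable_EFinP; exact: measurable_funX.
under eq_integral do rewrite /= ger0_norm ?sqr_ge0//.
rewrite ge0_integral_std_normal//; last by move=> x; rewrite lee_fin sqr_ge0.
pose c : R := 4 * normal_peak 1 / normal_peak (Num.sqrt 2).
apply: (@le_lt_trans _ _ (\int[mu]_x (c%:E * (normal_pdf 0 (Num.sqrt 2) x)%:E))%E).
  apply: ge0_le_integral => //.
  - by move=> x _; rewrite -EFinM lee_fin mulr_ge0 ?sqr_ge0 ?normal_pdf_ge0.
  - apply: emeasurable_funM => //.
    by apply/measurable_EFinP; exact: measurable_normal_pdf.
  - apply: emeasurable_funM => //.
    by apply/measurable_EFinP; exact: measurable_normal_pdf.
  - by move=> x _; rewrite -!EFinM lee_fin std_normal_sqr_pdf_le.
rewrite integralZl//; last exact: integrable_normal_pdf.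
by rewrite integral_normal_pdf mule1 ltry.
Qed.

(* This is 1, but only its positivity matters. *)
Definition normal_m2 : R := Ex std_normal (fun x => x ^+ 2).

(** A zero second moment would concentrate the law on {0}, a null set by absolute continuity. *)
Lemma normal_m2_gt0 : 0 < normal_m2.
Proof.
rewrite lt_def Ex_ge0 ?andbT; last by move=> x; exact: sqr_ge0.
apply/negP => /eqP m20.
have i0 : (\int[std_normal]_x `|(x ^+ 2)%:E| = 0)%E.
  have /integrableP[mx ix] := std_normal_L2.2.
  have := m20; rewrite /normal_m2 /Ex /Rintegral => h.
  under eq_integral do rewrite /= ger0_norm ?sqr_ge0//.
  rewrite -[LHS]fineK ?h//.
  rewrite ge0_fin_numE; last by apply: integral_ge0 => x _; rewrite lee_fin sqr_ge0.
  apply: le_lt_trans ix; rewrite le_eqVlt; apply/orP; left; apply/eqP.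
  by apply: eq_integral => x _ /=; rewrite ger0_norm ?sqr_ge0.
have mx : measurable_fun setT (fun x : R => (x ^+ 2)%:E).
  by apply/measurable_EFinP; exact: measurable_funX.
have /(ae_eq_integral_abs std_normal measurableT mx) [N [mN N0 subN]] := i0.
have : std_normal [set (0 : R)] = 0%E.
  have /null_content_dominatesP := @normal_prob_dominates R 0 1.
  by apply => //; exact: lebesgue_measure_set1.
have sT : [set: R] `<=` [set 0] `|` N.
  move=> x _; have [->|x0] := eqVneq x 0; [by left|right].
  apply: subN => /= /(_ I) -[] /eqP; rewrite sqrf_eq0.
  exact/negP.
move=> s0; have := probability_setT std_normal.
have : (std_normal setT <= std_normal [set 0%R] + std_normal N)%E.
  apply: (@le_trans _ _ (std_normal ([set 0%R] `|` N))).
    by apply: le_measure => //; rewrite inE//; exact: measurableU.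
  exact: measureU2.
by rewrite N0 s0 adde0 => h h1; move: h; rewrite h1 lee_fin ler10.
Qed.

(** The squared L2 error of clipping a standard normal variable at L; it controls the correlation
    lost by truncating the bets. *)
Definition normal_tail (L : R) := Ex std_normal (fun x => (x - clip L x) ^+ 2).

Lemma normal_tail_small (e : R) : 0 < e -> exists2 L, 0 < L & normal_tail L <= e.
Proof.
move=> e0.
pose f n (x : R) := ((x - clip n.+1%:R x) ^+ 2)%:E.
have mf n : measurable_fun setT (f n).
  apply/measurable_EFinP; apply: measurable_funX; apply: measurable_funB => //.
  exact: measurable_clip.
have cf : {ae std_normal, forall x, setT x -> f ^~ x @ \oo --> (0 : R)%:E}.
  apply: aeW => x _; apply: cvg_near_cst.
  exists (Num.truncn `|x|) => // n /= xn; rewrite /f clip_id ?subrr ?expr0n//.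
  apply: (le_trans (ltW (truncnS_gt _))); rewrite ler_nat; exact: leq_trans xn _.
have dom : {ae std_normal, forall x n, setT x -> (`|f n x| <= (x ^+ 2)%:E)%E}.
  apply: aeW => x n _; rewrite /f lee_fin ger0_norm ?sqr_ge0//.
  have n0 : (0 : R) <= n.+1%:R by [].
  have [h|h] := leP `|x| n.+1%:R.
    by rewrite clip_id// subrr expr0n/= sqr_ge0.
  have [_ E] := clip_gt n0 h.
  rewrite -(real_normK (num_real (x - _))) E -(real_normK (num_real x)).
  by rewrite lerXn2r ?nnegrE// ?subr_ge0 ?(ltW h)// lerBlDr lerDl.
have [_ _ cv] := @dominated_convergence _ _ _ std_normal setT measurableT f (cst 0%:E)
  (fun x => (x ^+ 2)%:E) mf (measurable_cst _) cf std_normal_L2.2 dom.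
have O : nbhs (0%E : \bar R) [set x | (x < e%:E)%E].
  apply: open_nbhs_nbhs; split; first exact: open_ereal_lt_ereal.
  by rewrite /= lte_fin.
rewrite integral0 in cv.
have [k _ Hk] := cv _ O.
exists k.+1%:R => //; have := Hk k (leqnn k) => /= h.
rewrite /normal_tail /Ex /Rintegral -lee_fin fineK; first exact: ltW.
rewrite ge0_fin_numE; first by apply: (lt_trans h); rewrite ltry.
by apply: integral_ge0 => x _; rewrite lee_fin sqr_ge0.
Qed.

End standard_normal.

(** * Moments of Gaussian variables from their laws *)

Section gaussian_transfer.
Context d (Omega : measurableType d) (R : realType) (P : probability Omega R).

Lemma integral_law (Q : probability (measurableTypeR R) R) (Y : Omega -> R) (f : R -> R) :
  measurable_fun setT Y -> (forall A, measurable A -> P (Y @^-1` A) = Q A) ->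
  measurable_fun setT f -> (forall x, 0 <= f x) ->
  (\int[P]_w (f (Y w))%:E = \int[Q]_x (f x)%:E)%E.
Proof.
move=> mY YQ mf f0.
have mf' : measurable_fun [set: measurableTypeR R] (EFin \o f) by exact/measurable_EFinP.
pose Y' : Omega -> measurableTypeR R := Y.
have mY' : measurable_fun setT Y' by [].
pose Z := MeasurableFun.Pack (MeasurableFun.Class (isMeasurableFun.Build _ _ _ _ Y' mY')).
rewrite -[RHS](@eq_measure_integral _ _ _ setT Q (distribution P Z)); last first.
  by move=> A mA _; exact: YQ.
by rewrite ge0_integral_distribution.
Qed.

Lemma Ex_law (Q : probability (measurableTypeR R) R) (Y : Omega -> R) (f : R -> R) :
  measurable_fun setT Y -> (forall A, measurable A -> P (Y @^-1` A) = Q A) ->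
  measurable_fun setT f -> (forall x, 0 <= f x) ->
  Ex P (fun w => f (Y w)) = Ex Q f.
Proof. by move=> *; congr fine; exact: integral_law. Qed.

Lemma L1_law (Q : probability (measurableTypeR R) R) (Y : Omega -> R) (f : R -> R) :
  measurable_fun setT Y -> (forall A, measurable A -> P (Y @^-1` A) = Q A) ->
  measurable_fun setT f -> (forall x, 0 <= f x) ->
  L1 Q f -> L1 P (fun w => f (Y w)).
Proof.
move=> mY YQ mf f0 /integrableP[_ fi]; apply/integrableP; split.
  by apply/measurable_EFinP; exact: measurableT_comp.
have -> : (\int[P]_x `|(EFin \o (fun w => f (Y w))) x| = \int[P]_x (f (Y x))%:E)%E.
  by apply: eq_integral => x _ /=; rewrite ger0_norm.
rewrite (integral_law mY YQ mf f0); apply: le_lt_trans fi.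
rewrite le_eqVlt; apply/orP; left; apply/eqP.
by apply: eq_integral => x _ /=; rewrite ger0_norm.
Qed.

Lemma unit_gaussian (Y : Omega -> R) : is_centered_gaussian P Y 1 ->
  [/\ L2 P Y, Ex P (fun w => Y w ^+ 2) = normal_m2 &
   forall L, Ex P (fun w => (Y w - clip L (Y w)) ^+ 2) = normal_tail L].
Proof.
move=> [mY YQ].
have {}YQ A : measurable A -> P (Y @^-1` A) = std_normal A.
  by move=> mA; rewrite YQ// /centered_normal_law oner_eq0 sqrtr1.
have msq : measurable_fun setT (fun x : R => x ^+ 2) by exact: measurable_funX.
have sq0 (x : R) : 0 <= x ^+ 2 by exact: sqr_ge0.
split.
- by split => //; apply: (L1_law mY YQ msq sq0); exact: std_normal_L2.2.
- exact: (Ex_law mY YQ msq sq0).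
- move=> L; apply: (Ex_law mY YQ (f := fun x => (x - clip L x) ^+ 2)).
    apply: measurable_funX; apply: measurable_funB => //; exact: measurable_clip.
  by move=> x; exact: sqr_ge0.
Qed.

Lemma degenerate_gaussian (Y : Omega -> R) : is_centered_gaussian P Y 0 ->
  L2 P Y /\ Ex P (fun w => Y w ^+ 2) = 0.
Proof.
move=> [mY YQ].
pose z : measurableTypeR R := 0.
have {}YQ A : measurable A -> P (Y @^-1` A) = dirac z A.
  by move=> mA; rewrite YQ// /centered_normal_law eqxx.
have msq : measurable_fun setT (fun x : R => x ^+ 2) by exact: measurable_funX.
have sq0 (x : R) : 0 <= x ^+ 2 by exact: sqr_ge0.
have I0 : (\int[dirac z]_x (x ^+ 2)%:E = 0)%E.
  rewrite integral_dirac//; last exact/measurable_EFinP.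
  by rewrite diracT mul1e expr0n.
split.
- split => //; apply: (L1_law mY YQ msq sq0).
  apply/integrableP; split; first exact/measurable_EFinP.
  by under eq_integral do rewrite /= ger0_norm//; rewrite I0.
- by rewrite (Ex_law mY YQ msq sq0) /Ex /Rintegral I0.
Qed.

End gaussian_transfer.

(** * Covariances of linear combinations of fractional Brownian motion *)

Section fBm_covariance.
Context d (Omega : measurableType d) (R : realType) (P : probability Omega R).
Variables (H : R) (W : R -> Omega -> R).
Hypotheses (H0 : 0 < H) (fW : is_fBm P H W).

(* A list of pairs (coefficient, time) encodes a linear combination of values of [W]. *)
Definition lincomb (l : seq (R * R)) (w : Omega) : R := \sum_(p <- l) p.1 * W p.2 w.
Definition lincov (l m : seq (R * R)) : R :=
  \sum_(p <- l) \sum_(q <- m) p.1 * q.1 * fBm_cov H p.2 q.2.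
Definition times_ge0 (l : seq (R * R)) := all (fun p => 0 <= p.2) l.
Definition scale_coefs (c : R) (l : seq (R * R)) := [seq (c * p.1, p.2) | p <- l].

Lemma lincomb_scale c l : lincomb (scale_coefs c l) = fun w => c * lincomb l w.
Proof.
apply/funext => w; rewrite /lincomb big_map mulr_sumr.
by apply: eq_bigr => p _ /=; rewrite mulrA.
Qed.

Lemma lincov_scale c l : lincov (scale_coefs c l) (scale_coefs c l) = c ^+ 2 * lincov l l.
Proof.
rewrite /lincov big_map mulr_sumr; apply: eq_bigr => p _.
by rewrite big_map mulr_sumr; apply: eq_bigr => q _ /=; ring.
Qed.

Lemma lincomb_gaussian l : times_ge0 l ->
  is_centered_gaussian P (lincomb l) (lincov l l).
Proof.
move=> /allP l0.
pose t (i : 'I_(size l)) := (nth (0, 0) l i).2.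
pose c (i : 'I_(size l)) := (nth (0, 0) l i).1.
have := fW.2 (size l) t c.
have sumE (F : R * R -> R) : \sum_(p <- l) F p = \sum_(i < size l) F (nth (0,0) l i).
  by rewrite (big_nth (0, 0)) big_mkord.
have -> : (fun w => \sum_(i < size l) c i * W (t i) w) = lincomb l.
  by apply/funext => w; rewrite /lincomb sumE.
have -> : \sum_(i < size l) \sum_(j < size l) c i * c j * fBm_cov H (t i) (t j) = lincov l l.
  rewrite /lincov sumE; apply: eq_bigr => i _.
  by rewrite sumE.
by apply => i; apply: l0; rewrite mem_nth.
Qed.

Lemma times_ge0_scale c l : times_ge0 l -> times_ge0 (scale_coefs c l).
Proof. by rewrite /times_ge0 all_map. Qed.

Lemma lincomb_normalized l : times_ge0 l -> 0 < lincov l l ->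
  is_centered_gaussian P (fun w => (Num.sqrt (lincov l l))^-1 * lincomb l w) 1.
Proof.
move=> l0 v0; set c := _^-1.
have := lincomb_gaussian (times_ge0_scale c l0).
have -> : lincov (scale_coefs c l) (scale_coefs c l) = 1.
  by rewrite lincov_scale /c exprVn sqr_sqrtr ?ltW// mulVf// gt_eqF.
by rewrite lincomb_scale.
Qed.

(** Dividing by the standard deviation reduces to the standard normal law; variance 0 is the Dirac
    case of [centered_normal_law]. Nonnegativity of the variance is assumed because [lincov_ge0] is
    itself deduced from special cases of this lemma. *)
Lemma lincomb_sqr l : times_ge0 l -> 0 <= lincov l l ->
  L2 P (lincomb l) /\ Ex P (fun w => lincomb l w ^+ 2) = normal_m2 * lincov l l.
Proof.
move=> l0; rewrite le_eqVlt => /predU1P[v0|v0].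
  have := lincomb_gaussian l0; rewrite -v0 => /degenerate_gaussian[? ->].
  by rewrite mulr0.
have [L2Y EY _] := unit_gaussian (lincomb_normalized l0 v0).
set s := Num.sqrt _ in L2Y EY.
have s0 : s != 0 by rewrite gt_eqF// sqrtr_gt0.
have E : lincomb l = fun w => s * (s^-1 * lincomb l w).
  by apply/funext => w; rewrite mulVKf.
have L2l : L2 P (lincomb l) by rewrite E; exact: L2Z.
split => //; rewrite -EY.
have -> : (fun w => (s^-1 * lincomb l w) ^+ 2) = (fun w => (lincov l l)^-1 * lincomb l w ^+ 2).
  by apply/funext => w; rewrite exprMn exprVn sqr_sqrtr// ltW.
by rewrite ExZ; [rewrite mulrAC mulVf ?mul1r// gt_eqF|exact: L2l.2].
Qed.

Lemma powR0_2H : (0 : R) `^ (2 * H) = 0.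
Proof. by rewrite powR0// mulf_neq0// gt_eqF. Qed.

Lemma fBm_cov_diag t : fBm_cov H t t = t `^ (2 * H).
Proof. by rewrite /fBm_cov subrr normr0 powR0_2H; field. Qed.

Lemma fBm_covC s t : fBm_cov H s t = fBm_cov H t s.
Proof. by rewrite /fBm_cov (addrC (s `^ _)) distrC. Qed.

Lemma fBm_L2 t : 0 <= t -> L2 P (W t) /\ Ex P (fun w => W t w ^+ 2) = normal_m2 * t `^ (2 * H).
Proof.
move=> t0; have : times_ge0 [:: (1, t)] by rewrite /times_ge0/= t0.
have E : lincov [:: (1, t)] [:: (1, t)] = t `^ (2 * H).
  by rewrite /lincov !big_seq1/= !mul1r fBm_cov_diag.
move=> /lincomb_sqr; rewrite E => /(_ (powR_ge0 _ _)).
have -> : lincomb [:: (1, t)] = W t; last by [].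
by apply/funext => w; rewrite /lincomb big_seq1 mul1r.
Qed.

(** Polarization: [is_fBm] gives only laws of single combinations, so the mixed moment is read off
    from the second moments of W s, W t and W s - W t. *)
Lemma Ex_fBmM s t : 0 <= s -> 0 <= t ->
  Ex P (fun w => W s w * W t w) = normal_m2 * fBm_cov H s t.
Proof.
move=> s0 t0; have [Ls Es] := fBm_L2 s0; have [Lt Et] := fBm_L2 t0.
have : times_ge0 [:: (1, s); (-1, t)] by rewrite /times_ge0/= s0 t0.
have E : lincov [:: (1, s); (-1, t)] [:: (1, s); (-1, t)] = `|t - s| `^ (2 * H).
  rewrite /lincov !big_cons !big_nil/= !fBm_cov_diag (fBm_covC t s) /fBm_cov.
  by field.
move=> /lincomb_sqr; rewrite E => /(_ (powR_ge0 _ _)) [_].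
have -> : lincomb [:: (1, s); (-1, t)] = (fun w => W s w + -1 * W t w).
  by apply/funext => w; rewrite /lincomb !big_cons big_nil addr0 mul1r.
rewrite Ex_sqrD//; last exact: L2Z.
have -> : (fun w => W s w * (-1 * W t w)) = (fun w => -1 * (W s w * W t w)).
  by apply/funext => w; ring.
have -> : (fun w => (-1 * W t w) ^+ 2) = (fun w => W t w ^+ 2).
  by apply/funext => w; ring.
rewrite ExZ; last exact: L2M.
by rewrite Es Et /fBm_cov; lra.
Qed.

Lemma lincomb_L2 l : times_ge0 l -> L2 P (lincomb l).
Proof.
elim: l => [_|p l ih /=/andP[p0 /ih Ll]].
  rewrite (_ : lincomb [::] = fun=> 0); first exact: L2_cst.
  by apply/funext => w; rewrite /lincomb big_nil.
rewrite (_ : lincomb (p :: l) = fun w => p.1 * W p.2 w + lincomb l w); last first.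
  by apply/funext => w; rewrite /lincomb big_cons.
by apply: L2D => //; apply: L2Z; exact: (fBm_L2 p0).1.
Qed.

Lemma Ex_lincombM l m : times_ge0 l -> times_ge0 m ->
  Ex P (fun w => lincomb l w * lincomb m w) = normal_m2 * lincov l m.
Proof.
move=> l0 m0.
have step t : 0 <= t -> Ex P (fun w => W t w * lincomb m w) =
    normal_m2 * \sum_(q <- m) q.1 * fBm_cov H t q.2.
  move=> t0; elim: m m0 => [_|q m ih /=/andP[q0 m0]].
    rewrite big_nil mulr0 -[RHS](Ex_cst P); congr (Ex P _); apply/funext => w.
    by rewrite /lincomb big_nil mulr0.
  rewrite big_cons mulrDr -ih//.
  rewrite (_ : (fun w => W t w * lincomb (q :: m) w) =
     fun w => q.1 * (W t w * W q.2 w) + W t w * lincomb m w); last first.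
    by apply/funext => w; rewrite /lincomb big_cons; ring.
  have Lt := (fBm_L2 t0).1; have Lq := (fBm_L2 q0).1.
  rewrite ExD; [|exact/L1Z/L2M|by apply: L2M => //; exact: lincomb_L2].
  by rewrite ExZ ?Ex_fBmM//; [ring|exact: L2M].
elim: l l0 => [_|p l ih /=/andP[p0 l0]].
  rewrite /lincov big_nil mulr0 -[RHS](Ex_cst P); congr (Ex P _); apply/funext => w.
  by rewrite /lincomb big_nil mul0r.
rewrite /lincov big_cons mulrDr -/(lincov l m) -ih//.
rewrite (_ : (fun w => lincomb (p :: l) w * lincomb m w) =
   fun w => p.1 * (W p.2 w * lincomb m w) + lincomb l w * lincomb m w); last first.
  by apply/funext => w; rewrite /lincomb big_cons; ring.
have Lp := (fBm_L2 p0).1.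
have Lm := lincomb_L2 m0; have Ll := lincomb_L2 l0.
rewrite ExD; [|exact/L1Z/L2M|exact: L2M].
rewrite ExZ ?step//; last exact: L2M.
congr (_ + _); rewrite mulrCA; congr (_ * _); rewrite mulr_sumr.
by apply: eq_bigr => q _; rewrite mulrA.
Qed.

(** Positivity of the kernel [fBm_cov] comes from the existence of W: the form is a second moment
    divided by [normal_m2]. *)
Lemma lincov_ge0 l : times_ge0 l -> 0 <= lincov l l.
Proof.
move=> l0; rewrite -(pmulr_rge0 _ normal_m2_gt0) -Ex_lincombM//.
by apply: Ex_ge0 => w; rewrite -expr2 sqr_ge0.
Qed.

Lemma nrm2_lincomb l : times_ge0 l ->
  nrm2 P (lincomb l) = Num.sqrt normal_m2 * Num.sqrt (lincov l l).
Proof.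
move=> l0; rewrite -sqrtrM ?(ltW normal_m2_gt0)//; congr Num.sqrt.
exact: (lincomb_sqr l0 (lincov_ge0 l0)).2.
Qed.

(** Clipping changes the normalized combination by an error of squared L2 norm [normal_tail L], and
    Cauchy-Schwarz bounds its effect on the product with G. *)
Lemma Ex_clip_lincomb (G : Omega -> R) l L : times_ge0 l -> 0 < lincov l l -> L2 P G ->
  (Num.sqrt (lincov l l))^-1 * Ex P (fun w => lincomb l w * G w) -
    Num.sqrt (normal_tail L) * nrm2 P G <=
  Ex P (fun w => clip L ((Num.sqrt (lincov l l))^-1 * lincomb l w) * G w).
Proof.
move=> l0 v0 LG; pose Y w := (Num.sqrt (lincov l l))^-1 * lincomb l w.
have [LY _ tailY] := unit_gaussian (lincomb_normalized l0 v0).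
rewrite -/Y in LY tailY; rewrite -[X in _ <= X]/(Ex P (fun w => clip L (Y w) * G w)).
have mc : measurable_fun setT (fun w => clip L (Y w)).
  by apply: measurableT_comp; [exact: measurable_clip|exact: LY.1].
pose Z w := Y w - clip L (Y w).
have LZ : L2 P Z.
  apply: L2B => //; apply: (@L2_bounded _ _ _ _ _ `|L|) => // w.
  rewrite ler_norml /clip; apply/andP; split.
    by rewrite le_max; apply/orP; left; rewrite lerN2 ler_norm.
  rewrite ge_max; apply/andP; split; first by rewrite -normrN ler_norm.
  by rewrite ge_min ler_norm orbT.
have LC : L2 P (fun w => clip L (Y w)).
  rewrite (_ : (fun w => _) = fun w => Y w - Z w); first exact: L2B.
  by apply/funext => w; rewrite /Z subKr.
have -> : (fun w => clip L (Y w) * G w) = (fun w => Y w * G w - Z w * G w).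
  by apply/funext => w; rewrite /Z; ring.
rewrite ExB; [|exact: L2M|exact: L2M].
have -> : (fun w => Y w * G w) = (fun w => (Num.sqrt (lincov l l))^-1 * (lincomb l w * G w)).
  by apply/funext => w; rewrite /Y mulrA.
rewrite ExZ; last by apply: L2M => //; exact: lincomb_L2.
rewrite lerD2l lerN2 (le_trans (ler_norm _))//.
rewrite (le_trans (cauchy_schwarz_Ex LZ LG))// ler_wpM2r ?nrm2_ge0//.
by rewrite /nrm2 tailY.
Qed.

End fBm_covariance.

(** * Increments of the Wiener-Weierstrass bridge over 1/b^m *)

Section power_differences.
Context {R : realType}.

Lemma is_derive_powR_shift (q h y : R) : 0 < y + h ->
  is_derive y 1 (fun z => (z + h) `^ q) (q * (y + h) `^ (q - 1)).
Proof.
move=> yh.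
have D1 : is_derive y 1 (fun z : R => z + h) 1.
  by apply: is_derive_eq; rewrite addr0.
have D2 : is_derive (y + h) 1 (fun z : R => z `^ q) (q * (y + h) `^ (q - 1)).
  exact: is_derive1_powR.
by have := @is_derive1_comp R (fun z => z `^ q) (fun z => z + h) y _ _ D2 D1; rewrite mulr1.
Qed.

Lemma powR_le_neg (q g y : R) : q <= 0 -> 0 < g -> g <= y -> y `^ q <= g `^ q.
Proof.
move=> q0 g0 gy; have y0 : 0 < y by exact: lt_le_trans gy.
rewrite -[q]opprK !(powRN _ (- q)) lef_pV2 ?posrE ?powR_gt0//.
by rewrite ge0_ler_powR ?nnegrE ?oppr_ge0// ltW.
Qed.

Lemma powR_MVT (q h x k : R) : 0 < x + h -> 0 <= k ->
  exists2 c, x <= c <= x + k &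
    (x + k + h) `^ q - (x + h) `^ q = q * (c + h) `^ (q - 1) * k.
Proof.
move=> xh k0; have xk : x <= x + k by rewrite lerDl.
have D z : z \in `[x, x + k] ->
    is_derive z 1 (fun z => (z + h) `^ q) (q * (z + h) `^ (q - 1)).
  rewrite in_itv/= => /andP[xz _]; apply: is_derive_powR_shift.
  by rewrite (lt_le_trans xh)// lerD2r.
have [c] := @MVT_segment R (fun z => (z + h) `^ q) (fun z => q * (z + h) `^ (q - 1))
  x (x + k) xk (fun z zI => D z (subset_itv_oo_cc zI))
  (derivable_within_continuous (fun z zI => @ex_derive _ _ _ _ _ _ _ (D z zI))).
by rewrite in_itv/= [x + k - x]addrAC subrr add0r => cI E; exists c.
Qed.

(** Mean value theorem in the direction k for z -> (z + h)^p - z^p, then in the direction h for its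
    derivative; as p - 2 <= 0, the resulting power is largest at the lower end g. *)
Lemma powR_second_difference (p g x h k : R) : p <= 2 -> 0 < g -> g <= x ->
  0 <= h -> 0 <= k ->
  `|(x + h + k) `^ p - (x + h) `^ p - (x + k) `^ p + x `^ p| <=
  `|p * (p - 1)| * g `^ (p - 2) * h * k.
Proof.
move=> p2 g0 gx h0 k0.
have x0 : 0 < x by exact: lt_le_trans gx.
(* [z + 0] gives both terms the shape required by [is_derive_powR_shift]. *)
pose phi z := (z + h) `^ p - (z + 0) `^ p.
pose dphi z := p * (z + h) `^ (p - 1) - p * (z + 0) `^ (p - 1).
have xk : x <= x + k by rewrite lerDl.
have D z : z \in `[x, x + k] -> is_derive z 1 phi (dphi z).
  rewrite in_itv/= => /andP[xz _].
  by apply: is_deriveB; apply: is_derive_powR_shift; lra.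
have [c] := @MVT_segment R phi dphi x (x + k) xk
  (fun z zI => D z (subset_itv_oo_cc zI))
  (derivable_within_continuous (fun z zI => @ex_derive _ _ _ _ _ _ _ (D z zI))).
rewrite in_itv/= [x + k - x]addrAC subrr add0r => /andP[xc _].
rewrite /phi /dphi !addr0.
have -> : (x + h + k) `^ p - (x + h) `^ p - (x + k) `^ p + x `^ p =
   (x + k + h) `^ p - (x + k) `^ p - ((x + h) `^ p - x `^ p).
  by rewrite (addrAC x h k); ring.
move=> ->.
have c0 : 0 < c by exact: lt_le_trans xc.
have [|e /andP[ce _] E] := @powR_MVT (p - 1) 0 c h _ h0; first by rewrite addr0.
rewrite !addr0 in E.
rewrite -mulrBr E normrM (ger0_norm k0) ler_wpM2r//.
rewrite !normrM (ger0_norm h0) mulrA ler_wpM2r// mulrA ler_wpM2l ?normr_ge0//.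
rewrite ger0_norm ?powR_ge0//.
have -> : p - 1 - 1 = p - 2 by ring.
by apply: powR_le_neg => //; [rewrite subr_le0|lra].
Qed.

End power_differences.

Local Notation frac := Defs.frac.

(** * Series over fractional parts *)

Section fractional_part_series.
Context {R : realType}.
Variables (alpha : R) (b : nat).
Hypotheses (alpha01 : 0 < alpha < 1) (b2 : (2 <= b)%N).
Local Notation B := (b%:R : R).

Lemma frac_itv (x : R) : 0 <= frac x < 1.
Proof.
rewrite /frac; have := floor_itv x; rewrite intrD => /andP[h1 h2].
by apply/andP; split; lra.
Qed.

Lemma frac_id (x : R) : 0 <= x < 1 -> frac x = x.
Proof.
move=> x01; rewrite /frac (_ : Num.floor x = 0) ?subr0//.
by apply: floor_def; rewrite add0r.
Qed.

Lemma frac_addn (x : R) (k : nat) : frac (x + k%:R) = frac x.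
Proof.
rewrite /frac (_ : Num.floor (x + k%:R) = Num.floor x + k%:Z).
  by rewrite intrD -pmulrn; ring.
apply: floor_def; have := floor_itv x; rewrite !intrD -!pmulrn => /andP[h1 h2].
by apply/andP; split; lra.
Qed.

Variables (f : R -> R) (C : R).
Hypothesis fC : forall x, 0 <= x < 1 -> `|f x| <= C.

Definition frac_sum (t : R) (N : nat) : R :=
  \sum_(n < N) alpha ^+ n * f (frac (B ^+ n * t)).

Lemma frac_sum_cvg t : cvgn (frac_sum t).
Proof.
pose u n := alpha ^+ n * f (frac (B ^+ n * t)).
have -> : frac_sum t = series u.
  by apply/funext => N; rewrite /series/= big_mkord.
apply: normed_cvg.
apply: (@series_le_cvg _ _ (geometric C alpha)).
- by move=> n; exact: normr_ge0.
- move=> n; have := fC (frac_itv (B ^+ n * t)) => h.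
  by rewrite mulr_ge0 ?exprn_ge0//; [exact: le_trans h|case/andP: alpha01 => /ltW].
- move=> n; rewrite /= /u normrM normrX gtr0_norm; last by case/andP: alpha01.
  rewrite mulrC ler_wpM2r ?exprn_ge0//; first by case/andP: alpha01 => /ltW.
  exact/fC/frac_itv.
- apply: is_cvg_geometric_series; rewrite gtr0_norm; by case/andP: alpha01.
Qed.

(** For n > m the argument moves by the integer b^(n - m - 1), invisible to [frac]. The partial sums
    at t' and t thus differ by a constant from index m + 1 on, and so do their limits. *)
Lemma frac_sum_shift m t : let t' := t + B ^- m.+1 in
  limn (frac_sum t') - limn (frac_sum t) =
  \sum_(n < m.+1) alpha ^+ n * (f (frac (B ^+ n * t')) - f (frac (B ^+ n * t))).
Proof.
move=> t'; set D := \sum_(n < m.+1) _.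
have B0 : B != 0 by rewrite pnatr_eq0 -lt0n (leq_trans _ b2).
suff cv : frac_sum t' @ \oo --> limn (frac_sum t) + D.
  by rewrite (cvg_lim _ cv)//; rewrite addrAC subrr add0r.
have cvD : (fun N => frac_sum t N + D) @ \oo --> limn (frac_sum t) + D.
  by apply: cvgD; [exact: frac_sum_cvg|exact: cvg_cst].
apply: cvg_trans cvD; apply: near_eq_cvg.
exists m.+1 => // N /= mN.
rewrite /frac_sum -(subnKC mN).
rewrite !(@big_split_ord _ _ _ m.+1)/=.
rewrite addrAC; congr (_ + _).
  by rewrite /D -big_split/=; apply: eq_bigr => i _; ring.
apply: eq_bigr => i _; congr (_ * f _).
rewrite /t' mulrDr exprD -[X in _ = frac (_ + X)]mulrA.
rewrite -(frac_addn (B ^+ m.+1 * B ^+ i * t) (b ^ i)); congr frac; congr (_ + _).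
by rewrite natrX mulrCA divff ?mulr1// expf_neq0.
Qed.

End fractional_part_series.

(** Paths are continuous for every w, hence bounded on [0, 1]; the series defining X then converges
    at every w, with no null set to discard. *)
Lemma fbridge_bounded (Omega : Type) (R : realType) (W : R -> Omega -> R)
    (kappa : R -> R) (w : Omega) :
  {within [set t : R | 0 <= t], continuous (fun t => W t w)} ->
  (forall t, 0 <= t <= 1 -> 0 <= kappa t <= 1) ->
  exists C, forall x, 0 <= x < 1 -> `|fbridge W kappa x w| <= C.
Proof.
move=> cW k01.
have cW' : {within `[0, 1], continuous (fun t => W t w)}.
  by apply: continuous_subspaceW cW => x /=; rewrite in_itv/= => /andP[].
have [c _ Hc] := EVT_max ler01 cW'.
have [e _ He] := EVT_min ler01 cW'.
exists (`|W c w| + `|W e w| + `|W 1 w|) => x /andP[x0 x1].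
have xI : x \in `[0, 1] by rewrite in_itv/= x0 ltW.
have h1 := Hc x xI; have h2 := He x xI.
have /andP[k0 k1] : 0 <= kappa x <= 1 by apply: k01; rewrite x0 ltW.
have h : `|kappa x * W 1 w| <= `|W 1 w| by rewrite normrM ler_piMl// ger0_norm.
rewrite /fbridge (le_trans (ler_normB _ _))//.
have h3 := ler_norm (W c w); have h4 := ler_norm (- W e w); rewrite normrN in h4.
have h5 := normr_ge0 (W c w); have h6 := normr_ge0 (W e w).
by apply: lerD => //; rewrite ler_norml; apply/andP; split; lra.
Qed.

Lemma fWW_bridge_shift (Omega : Type) (R : realType) (alpha : R) (b : nat)
    (W : R -> Omega -> R) (kappa : R -> R) (w : Omega) (m : nat) (t : R) :
  0 < alpha < 1 -> (2 <= b)%N ->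
  {within [set t : R | 0 <= t], continuous (fun t => W t w)} ->
  (forall t, 0 <= t <= 1 -> 0 <= kappa t <= 1) ->
  let t' := t + b%:R ^- m.+1 in
  fWW_bridge alpha b W kappa t' w - fWW_bridge alpha b W kappa t w =
  \sum_(n < m.+1) alpha ^+ n * (fbridge W kappa (frac (b%:R ^+ n * t')) w -
                                fbridge W kappa (frac (b%:R ^+ n * t)) w).
Proof.
move=> a01 b2 cW k01; have [C fC] := fbridge_bounded cW k01.
exact: (frac_sum_shift a01 b2 fC m t).
Qed.

(** * Correlation estimates *)

Section l2_estimates.
Context d (T : measurableType d) (R : realType) (P : probability T R).
Local Notation E := (Ex P).
Local Notation nrm := (nrm2 P).

Lemma nrm2B (f g : T -> R) : L2 P f -> L2 P g -> nrm (fun x => f x - g x) <= nrm f + nrm g.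
Proof.
move=> Lf Lg; have := nrm2D Lf (L2Z (-1) Lg).
rewrite nrm2Z// normrN1 mul1r.
by have -> : (fun x => f x + -1 * g x) = (fun x => f x - g x) by apply/funext => x; ring.
Qed.

Lemma Ex_sqrB (f g : T -> R) : L2 P f -> L2 P g -> E (fun x => (f x - g x) ^+ 2) =
  nrm f ^+ 2 - 2 * E (fun x => f x * g x) + nrm g ^+ 2.
Proof.
move=> Lf Lg; rewrite !nrm2_sqr; have := Ex_sqrD Lf (L2Z (-1) Lg).
have -> : (fun x => (f x + -1 * g x) ^+ 2) = (fun x => (f x - g x) ^+ 2).
  by apply/funext => x; ring.
have -> : (fun x => f x * (-1 * g x)) = (fun x => -1 * (f x * g x)).
  by apply/funext => x; ring.
have -> : (fun x => (-1 * g x) ^+ 2) = (fun x => g x ^+ 2) by apply/funext => x; ring.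
by rewrite ExZ; [move=> ->; ring|exact: L2M].
Qed.

(* [G] is a signal, seen in [Y] with factor [alpha ^+ 2] under an almost uncorrelated noise; the
   constant 30 makes the 15 error terms [e * a ^+ 2] of the expansion of E[Y G] at most half of
   [alpha ^+ 2 * a ^+ 2]. *)
Lemma correlation_lower_bound (alpha a e : R) (I1 I2 J1 J2 J3 J4 KG KN : T -> R) :
  0 < alpha <= 1 -> 0 < a -> 0 <= e -> 30 * e <= alpha ^+ 2 ->
  L2 P I1 -> L2 P I2 -> L2 P J1 -> L2 P J2 -> L2 P J3 -> L2 P J4 -> L2 P KG -> L2 P KN ->
  nrm I1 = a -> nrm I2 = a ->
  nrm J1 <= a -> nrm J2 <= a -> nrm J3 <= a -> nrm J4 <= a ->
  nrm KG <= e * a -> nrm KN <= e * a ->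
  `|E (fun w => I2 w * I1 w)| <= e * a ^+ 2 ->
  (forall I, I = I1 \/ I = I2 -> forall J, [\/ J = J1, J = J2, J = J3 | J = J4] ->
    `|E (fun w => I w * J w)| <= e * a ^+ 2) ->
  let G w := I1 w - I2 w - KG w in
  let Y w := J1 w - J2 w + alpha * (J3 w - J4 w) - KN w + alpha ^+ 2 * G w in
  [/\ a <= nrm G, nrm Y <= 8 * nrm G &
      alpha ^+ 2 / 2 * nrm G ^+ 2 <= E (fun w => Y w * G w)].
Proof.
move=> /andP[al0 al1] a0 e0 ea LI1 LI2 LJ1 LJ2 LJ3 LJ4 LKG LKN nI1 nI2 nJ1 nJ2 nJ3 nJ4
  nKG nKN cI cIJ G Y.
have al2 : alpha ^+ 2 <= 1 by rewrite exprn_ile1// ltW.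
have al20 : 0 <= alpha ^+ 2 by exact: sqr_ge0.
pose D w := I1 w - I2 w.
have LD : L2 P D by exact: L2B.
have LG : L2 P G by exact: L2B.
pose N0 w := J1 w - J2 w + alpha * (J3 w - J4 w).
have LN0 : L2 P N0 by apply: L2D; [exact: L2B|exact/L2Z/L2B].
pose N w := N0 w - KN w.
have LN : L2 P N by exact: L2B.
have a2 : 0 < a ^+ 2 by rewrite exprn_gt0.
have D2 : nrm D ^+ 2 >= (2 - 2 * e) * a ^+ 2.
  rewrite nrm2_sqr Ex_sqrB// nI1 nI2.
  have -> : E (fun x => I1 x * I2 x) = E (fun w => I2 w * I1 w).
    by congr (Ex P _); apply/funext => x; rewrite mulrC.
  move: cI; rewrite ler_norml => /andP[_]; lra.
have nDle : nrm D <= 2 * a.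
  by have := nrm2B LI1 LI2; rewrite nI1 nI2; lra.
(* (1 + e)^2 <= 1 + 3 e <= 2 - 2 e because e <= 1/30. The margin e a is what subtracting [KG] may
   cost, so G keeps norm at least a. *)
have nDge : (1 + e) * a <= nrm D.
  rewrite -ler_sqr ?nnegrE ?nrm2_ge0 ?mulr_ge0 ?(ltW a0)//; last by lra.
  apply: le_trans D2; rewrite exprMn ler_wpM2r ?(ltW a2)//.
  have : e ^+ 2 <= e by rewrite expr2 ler_piMl//; lra.
  by lra.
have nGge : a <= nrm G.
  have DE : D = fun w => G w + KG w by apply/funext => w; rewrite /G subrK.
  have : nrm D <= nrm G + nrm KG by rewrite DE; exact: nrm2D.
  by lra.
have nGle : nrm G <= 3 * a.
  have : nrm G <= nrm D + nrm KG by exact: nrm2B.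
  have : e * a <= 1 * a by rewrite ler_wpM2r ?ltW//; lra.
  by lra.
have nN0 : nrm N0 <= 4 * a.
  have h1 : nrm N0 <= nrm (fun w => J1 w - J2 w) + nrm (fun w => alpha * (J3 w - J4 w)).
    by apply: nrm2D; [exact: L2B|exact/L2Z/L2B].
  have h2 := nrm2B LJ1 LJ2; have h3 := nrm2B LJ3 LJ4.
  rewrite nrm2Z in h1; last exact: L2B.
  rewrite gtr0_norm// in h1.
  have : alpha * nrm (fun x => J3 x - J4 x) <= 1 * nrm (fun x => J3 x - J4 x).
    by rewrite ler_wpM2r ?nrm2_ge0.
  by lra.
have nN : nrm N <= 5 * a.
  have : nrm N <= nrm N0 + nrm KN by exact: nrm2B.
  have : e * a <= 1 * a by rewrite ler_wpM2r ?ltW//; lra.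
  by lra.
have G0 : 0 <= nrm G by exact: nrm2_ge0.
have nY : nrm Y <= 8 * nrm G.
  have : nrm Y <= nrm N + nrm (fun w => alpha ^+ 2 * G w) by apply: nrm2D => //; exact: L2Z.
  rewrite nrm2Z// (ger0_norm al20).
  have : alpha ^+ 2 * nrm G <= 1 * nrm G by rewrite ler_wpM2r.
  by lra.
split => //.
have eDN0 : `|E (fun w => D w * N0 w)| <= 8 * (e * a ^+ 2).
  have -> : (fun w => D w * N0 w) = (fun w =>
     ((I1 w * J1 w - I1 w * J2 w) + alpha * (I1 w * J3 w - I1 w * J4 w)) -
     ((I2 w * J1 w - I2 w * J2 w) + alpha * (I2 w * J3 w - I2 w * J4 w))).
    by apply/funext => w; rewrite /D /N0; ring.
  have one I : L2 P I -> (I = I1 \/ I = I2) ->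
    L1 P (fun w => (I w * J1 w - I w * J2 w) + alpha * (I w * J3 w - I w * J4 w)) /\
    `|E (fun w => (I w * J1 w - I w * J2 w) + alpha * (I w * J3 w - I w * J4 w))| <=
      4 * (e * a ^+ 2).
    move=> LI Ior.
    have h1 := cIJ I Ior J1 (Or41 _ _ _ erefl); have h2 := cIJ I Ior J2 (Or42 _ _ _ erefl).
    have h3 := cIJ I Ior J3 (Or43 _ _ _ erefl); have h4 := cIJ I Ior J4 (Or44 _ _ _ erefl).
    have m1 := L2M LI LJ1; have m2 := L2M LI LJ2; have m3 := L2M LI LJ3; have m4 := L2M LI LJ4.
    have L12 := L1B m1 m2; have L34 := L1B m3 m4.
    split; first by apply: L1D => //; exact: L1Z.
    rewrite ExD//; last exact: L1Z.
    rewrite ExZ// !ExB//.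
    set x1 := E (fun w => I w * J1 w) in h1 *; set x2 := E (fun w => I w * J2 w) in h2 *.
    set x3 := E (fun w => I w * J3 w) in h3 *; set x4 := E (fun w => I w * J4 w) in h4 *.
    rewrite (le_trans (ler_normD _ _))// normrM (gtr0_norm al0).
    have h12 := ler_normB x1 x2; have h34 := ler_normB x3 x4.
    have : alpha * `|x3 - x4| <= 1 * `|x3 - x4| by rewrite ler_wpM2r.
    by lra.
  have [L1a h1] := one I1 LI1 (or_introl erefl).
  have [L1b h2] := one I2 LI2 (or_intror erefl).
  rewrite ExB// (le_trans (ler_normB _ _))//; lra.
have cDK := cauchy_schwarz_Ex LD LKN.
have cKN := cauchy_schwarz_Ex LKG LN.
have hDK : nrm D * nrm KN <= 2 * a * (e * a) by rewrite ler_pM ?nrm2_ge0.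
have hKN : nrm KG * nrm N <= e * a * (5 * a) by rewrite ler_pM ?nrm2_ge0.
(* In units of e a^2 the three error terms are at most 8, 2 and 5. *)
have EGY : E (fun w => Y w * G w) = E (fun w => D w * N0 w) - E (fun w => D w * KN w)
    - E (fun w => KG w * N w) + alpha ^+ 2 * nrm G ^+ 2.
  have -> : (fun w => Y w * G w) = (fun w => D w * N0 w - D w * KN w
    - KG w * N w + alpha ^+ 2 * (G w ^+ 2)).
    by apply/funext => w; rewrite /Y /N -/(N0 w) /G -/(D w); ring.
  have m1 := L2M LD LN0; have m2 := L2M LD LKN; have m3 := L2M LKG LN.
  rewrite ExD; [|by apply: L1B => //; exact: L1B|exact/L1Z/LG.2].
  rewrite ExB//; last exact: L1B.
  by rewrite ExB// ExZ ?nrm2_sqr//; exact: LG.2.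
rewrite EGY.
have aG : a ^+ 2 <= nrm G ^+ 2 by rewrite ler_sqr ?nnegrE ?(ltW a0).
have : alpha ^+ 2 * a ^+ 2 <= alpha ^+ 2 * nrm G ^+ 2 by rewrite ler_wpM2l.
have : 30 * e * a ^+ 2 <= alpha ^+ 2 * a ^+ 2 by apply: ler_wpM2r => //; exact: ltW.
rewrite (_ : 2 * a * (e * a) = 2 * (e * a ^+ 2)) in hDK; last by ring.
rewrite (_ : e * a * (5 * a) = 5 * (e * a ^+ 2)) in hKN; last by ring.
move: (le_trans cDK hDK) (le_trans cKN hKN) eDN0; rewrite !ler_norml.
move=> /andP[_ h1] /andP[_ h2] /andP[h3 _].
by lra.
Qed.

(** S <= K + 1_A |S| with A the event |S| > K, and Cauchy-Schwarz applies to the product. *)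
Lemma tight_mean (S : T -> R) (K g eta : R) : L2 P S -> 0 <= K -> nrm S <= g ->
  fine (P [set w | K < `|S w|]) <= eta -> E S <= K + Num.sqrt eta * g.
Proof.
move=> LS K0 Sg PK; set A := [set w | _] in PK.
have mA : measurable A by apply: measurable_gt; apply: measurableT_comp => //; exact: LS.1.
have LN : L2 P (fun w => `|S w|).
  split; first by apply: measurableT_comp => //; exact: LS.1.
  rewrite (_ : (fun x => _) = fun x => S x ^+ 2); first exact: LS.2.
  by apply/funext => x; rewrite real_normK ?num_real.
have LA : L2 P \1_A by exact: L2_indic.
have m := L2M LA LN.
apply: (@le_trans _ _ (E (fun w => K + \1_A w * `|S w|))).
  apply: Ex_le; [exact: L2_L1|by apply: L1D => //; exact: (L1_cst P)|] => w.
  have [Kw|wK] := ltP K `|S w|.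
    rewrite indicE mem_set// mul1r (le_trans (ler_norm _))//.
    by rewrite lerDr.
  rewrite (le_trans (ler_norm _))// (le_trans wK)// lerDl mulr_ge0//.
rewrite ExD//; last exact: (L1_cst P).
rewrite Ex_cst lerD2l (le_trans (ler_norm _))//.
rewrite (le_trans (cauchy_schwarz_Ex LA LN))// ler_pM ?nrm2_ge0//.
  by rewrite nrm2_indic// ler_wsqrtr.
apply: le_trans Sg; rewrite le_eqVlt; apply/orP; left; apply/eqP.
by congr (Num.sqrt (Ex P _)); apply/funext => x; rewrite real_normK ?num_real.
Qed.

End l2_estimates.

Lemma powR_div_small (R : realType) (l p e : R) : 0 < l -> 0 < p -> 0 < e ->
  exists n0 : nat, forall n : nat, (n0 <= n)%N -> (l / n.+1%:R) `^ p <= e.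
Proof.
move=> l0 p0 e0; pose y := e `^ p^-1.
have y0 : 0 < y by exact: powR_gt0.
exists (Num.truncn (l / y)) => n hn.
have -> : e = y `^ p by rewrite /y -powRrM mulVf ?gt_eqF// powRr1// ltW.
rewrite ge0_ler_powR ?nnegrE ?(ltW p0) ?(ltW y0) ?divr_ge0 ?(ltW l0)//.
rewrite ler_pdivrMr// mulrC -ler_pdivrMr//.
by rewrite (le_trans (ltW (truncnS_gt _)))// ler_nat.
Qed.

(** * Increments of fractional Brownian motion *)

Section fBm_increments.
Context d (Omega : measurableType d) (R : realType) (P : probability Omega R).
Variables (H : R) (W : R -> Omega -> R).
Hypotheses (H01 : 0 < H < 1) (fW : is_fBm P H W).

Definition incr_list (s h : R) : seq (R * R) := [:: (1, s + h); (-1, s)].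
Definition incr (s h : R) (w : Omega) : R := W (s + h) w - W s w.

Lemma incrE s h : incr s h = lincomb W (incr_list s h).
Proof.
by apply/funext => w; rewrite /lincomb !big_cons big_nil/= /incr; ring.
Qed.

Let H0 : 0 < H. Proof. by case/andP: H01. Qed.

Lemma incr_list_ge0 s h : 0 <= s -> 0 <= h -> times_ge0 (incr_list s h).
Proof. by move=> s0 h0; rewrite /times_ge0/= s0 addr_ge0. Qed.

Lemma incr_L2 s h : 0 <= s -> 0 <= h -> L2 P (incr s h).
Proof. by move=> s0 h0; rewrite incrE; apply: (lincomb_L2 H0 fW); exact: incr_list_ge0. Qed.

Lemma nrm2_incr s h : 0 <= s -> 0 <= h ->
  nrm2 P (incr s h) = Num.sqrt normal_m2 * h `^ H.
Proof.
move=> s0 h0; rewrite incrE (nrm2_lincomb H0 fW); last exact: incr_list_ge0.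
have -> : lincov H (incr_list s h) (incr_list s h) = h `^ (2 * H).
  rewrite /lincov !big_cons !big_nil/= !(fBm_cov_diag H0) (fBm_covC _ s (s + h)) /fBm_cov.
  rewrite [s - (s + h)](_ : _ = - h) ?normrN ?(ger0_norm h0); last by ring.
  by field.
by rewrite (mulrC 2) powRrM powR_mulrn ?powR_ge0// sqrtr_sqr ger0_norm// powR_ge0.
Qed.

(* For [h, k <= delta] this is O(delta^2), hence negligible with respect to the variances
   delta^(2H), whatever [H < 1]. *)
Lemma incr_cov_le g s h c k : 0 < g -> 0 <= s -> 0 <= h -> 0 <= k -> s + h + g <= c ->
  `|Ex P (fun w => incr s h w * incr c k w)| <=
  normal_m2 * (`|2 * H * (2 * H - 1)| * g `^ (2 * H - 2) * h * k).
Proof.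
move=> g0 s0 h0 k0 gap; have c0 : 0 <= c by lra.
rewrite !incrE (Ex_lincombM H0 fW); [|exact: incr_list_ge0|exact: incr_list_ge0].
rewrite normrM (gtr0_norm normal_m2_gt0) ler_wpM2l ?(ltW normal_m2_gt0)//.
have H2 : 2 * H <= 2 by case/andP: H01 => _ ?; lra.
pose x := c - s - h.
have gx : g <= x by rewrite /x; lra.
have x0 : 0 <= x by lra.
have := powR_second_difference H2 g0 gx h0 k0; set Q := _ * h * k; set z := _ + x `^ _ => hz.
(* With x the gap between the two intervals, the powers of single times cancel and half a second
   difference of x^(2H) remains. *)
have -> : lincov H (incr_list s h) (incr_list c k) = z / 2.
  rewrite /lincov !big_cons !big_nil/= /fBm_cov.
  have -> : c + k - (s + h) = x + k by rewrite /x; ring.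
  have -> : c - (s + h) = x by rewrite /x; ring.
  have -> : c + k - s = x + h + k by rewrite /x; ring.
  have -> : c - s = x + h by rewrite /x; ring.
  have xh := addr_ge0 x0 h0.
  rewrite (ger0_norm (addr_ge0 x0 k0)) (ger0_norm x0) (ger0_norm (addr_ge0 xh k0)) (ger0_norm xh).
  by rewrite /z; field.
rewrite normrM (ger0_norm (_ : 0 <= 2^-1))//.
by have := normr_ge0 z; lra.
Qed.

End fBm_increments.

Lemma lincomb_cat (R : realType) (d : measure_display)
    (Omega : measurableType d) (W : R -> Omega -> R) l m w :
  lincomb W (l ++ m) w = lincomb W l w + lincomb W m w.
Proof. by rewrite /lincomb big_cat. Qed.

(* The intervals [u, u + dl] and [u + B, u + B + dl] stay at distance at least [B ^+ 5] from each
   other and from their images under the scalings by [B] and [B ^+ 2]. *)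
Lemma grid_gaps (R : realFieldType) (B u dl : R) : 0 < B -> B <= 1 / 2 ->
  B ^+ 2 <= u -> 0 < dl -> u + dl <= B ^+ 2 + B ^+ 5 ->
  [/\ [/\ 0 <= u, 0 <= u * B & 0 <= u * B ^+ 2],
      [/\ 0 <= dl * B, dl * B <= dl, 0 <= dl * B ^+ 2 & dl * B ^+ 2 <= dl],
      [/\ u + B + dl < 1, u + dl <= 1, u * B + B ^+ 2 + dl * B <= 1 &
          u * B ^+ 2 + B ^+ 3 + dl * B ^+ 2 <= 1 /\
          (u * B + dl * B <= 1 /\ u * B ^+ 2 + dl * B ^+ 2 <= 1)],
      [/\ u + dl + B ^+ 5 <= u + B, u * B ^+ 2 + B ^+ 3 + dl * B ^+ 2 + B ^+ 5 <= u,
          u * B ^+ 2 + dl * B ^+ 2 + B ^+ 5 <= u & u * B + dl * B + B ^+ 5 <= u] &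
      u + dl + B ^+ 5 <= u * B + B ^+ 2 /\ u * B + B ^+ 2 + dl * B + B ^+ 5 <= u + B].
Proof.
move=> B0 B1 uge dl0 ule.
have B0' := ltW B0; have dl0' := ltW dl0.
have u0 : 0 <= u by rewrite (le_trans _ uge)// exprn_ge0.
(* To [lra] the powers of B are unrelated atoms; this links consecutive ones. *)
have step n : 2 * B ^+ n.+1 <= B ^+ n.
  by rewrite exprS mulrA ler_piMl ?exprn_ge0//; lra.
have p6 := step 6; have p5 := step 5; have p4 := step 4; have p3 := step 3.
have p2 := step 2; have p1 := step 1%N; rewrite expr1 in p1.
have [B20 B30] : 0 <= B ^+ 2 /\ 0 <= B ^+ 3 by rewrite !exprn_ge0.
have e1 : u * B + dl * B <= B ^+ 3 + B ^+ 6.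
  have := ler_wpM2r B0' ule; have -> // : (B ^+ 2 + B ^+ 5) * B = B ^+ 3 + B ^+ 6 by ring.
  by rewrite mulrDl.
have e2 : u * B ^+ 2 + dl * B ^+ 2 <= B ^+ 4 + B ^+ 7.
  have := ler_wpM2r B20 ule; have -> // : (B ^+ 2 + B ^+ 5) * B ^+ 2 = B ^+ 4 + B ^+ 7 by ring.
  by rewrite mulrDl.
have e3 : B ^+ 3 <= u * B.
  have := ler_wpM2r B0' uge; have -> // : B ^+ 2 * B = B ^+ 3 by ring.
have d1 : dl * B <= dl by rewrite ler_piMr//; lra.
have d2 : dl * B ^+ 2 <= dl by rewrite ler_piMr//; lra.
have z2 : 0 <= u * B ^+ 2 by rewrite mulr_ge0.
have z3 : 0 <= dl * B by rewrite mulr_ge0.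
have z4 : 0 <= dl * B ^+ 2 by rewrite mulr_ge0.
by do !split => //; lra.
Qed.

(** * Increments of the bridge at lags 1/b and 1/b^3 *)

Section bridge_increments.
Context d (Omega : measurableType d) (R : realType) (P : probability Omega R).
Variables (H alpha : R) (b : nat) (W : R -> Omega -> R) (kappa : R -> R) (tau C : R).
Hypotheses (H01 : 0 < H < 1) (alpha01 : 0 < alpha < 1) (b2 : (2 <= b)%N).
Hypothesis fW : is_fBm P H W.
Hypothesis kappa01 : forall t, 0 <= t <= 1 -> 0 <= kappa t <= 1.
Hypothesis Htau : H < tau <= 1.
Hypothesis kappaC : forall s t, 0 <= s <= 1 -> 0 <= t <= 1 ->
  `|kappa t - kappa s| <= C * `|t - s| `^ tau.
Local Notation X := (fWW_bridge alpha b W kappa).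
Variable B : R.
Hypothesis BE : B = b%:R^-1.

Lemma base_inv : 0 < B /\ B <= 1 / 2.
Proof.
have b0 : 0 < b%:R :> R by rewrite ltr0n (leq_trans _ b2).
by rewrite BE invr_gt0 b0 div1r lef_pV2 ?posrE// ler_nat.
Qed.

Definition dkappa (s h : R) := kappa (s + h) - kappa s.

Lemma bridge_shift1 (u : R) w : 0 <= u -> u + B < 1 ->
  X (u + B) w - X u w = W (u + B) w - W u w - (kappa (u + B) - kappa u) * W 1 w.
Proof.
move=> u0 uB; have [B0 _] := base_inv.
have := fWW_bridge_shift 0 u alpha01 b2 (fW.1 w) kappa01.
rewrite /= expr1 -BE => ->; rewrite big_ord1 expr0 !mul1r.
rewrite !frac_id; [|by rewrite u0; lra|by rewrite uB addr_ge0// ltW].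
by rewrite /fbridge; ring.
Qed.

(** Three scales survive for the lag b^(-3); at the last one, multiplication by b^2 brings the
    argument back to u, and this is the copy of V(u). *)
Lemma bridge_shift3 (u : R) w : 0 <= u -> u + B < 1 ->
  X (u * B ^+ 2 + B ^+ 3) w - X (u * B ^+ 2) w =
  W (u * B ^+ 2 + B ^+ 3) w - W (u * B ^+ 2) w
  + alpha * (W (u * B + B ^+ 2) w - W (u * B) w)
  + alpha ^+ 2 * (W (u + B) w - W u w)
  - ((kappa (u * B ^+ 2 + B ^+ 3) - kappa (u * B ^+ 2))
    + alpha * (kappa (u * B + B ^+ 2) - kappa (u * B))
    + alpha ^+ 2 * (kappa (u + B) - kappa u)) * W 1 w.
Proof.
move=> u0 uB; have [B0 B1] := base_inv.
have b0 : b%:R != 0 :> R by rewrite pnatr_eq0 -lt0n (leq_trans _ b2).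
have := fWW_bridge_shift 2 (u * B ^+ 2) alpha01 b2 (fW.1 w) kappa01.
rewrite /= -exprVn -BE => ->; rewrite !big_ord_recr big_ord0/= expr0 expr1 !mul1r add0r.
have -> : b%:R ^+ 2 * (u * B ^+ 2 + B ^+ 3) = u + B by rewrite BE; field.
have -> : b%:R ^+ 2 * (u * B ^+ 2) = u by rewrite BE; field.
have -> : b%:R * (u * B ^+ 2 + B ^+ 3) = u * B + B ^+ 2 by rewrite BE; field.
have -> : b%:R * (u * B ^+ 2) = u * B by rewrite BE; field.
have Ble x : 0 <= x -> x < 1 -> 0 <= x * B < 1.
  move=> x0 x1; rewrite mulr_ge0 ?(ltW B0)//=.
  by apply: le_lt_trans x1; rewrite ler_piMr//; lra.
have h1 : 0 <= u * B < 1 by apply: Ble => //; lra.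
have h2 : 0 <= u * B + B ^+ 2 < 1.
  by rewrite expr2 -mulrDl; apply: Ble => //; lra.
have h3 : 0 <= u * B ^+ 2 < 1.
  by rewrite expr2 mulrA; case/andP: h1 => ? ?; apply: Ble.
have h4 : 0 <= u * B ^+ 2 + B ^+ 3 < 1.
  rewrite (_ : u * B ^+ 2 + B ^+ 3 = (u * B + B ^+ 2) * B); last by ring.
  by case/andP: h2 => ? ?; apply: Ble.
rewrite !frac_id//; [|by apply/andP; split; lra|by apply/andP; split; lra].
by rewrite /fbridge; ring.
Qed.

Variables (u dl : R).
Hypotheses (uge : B ^+ 2 <= u) (dl0 : 0 < dl) (ule : u + dl <= B ^+ 2 + B ^+ 5).

(* With V u := X (u + B) - X u and V' u := X (u * B ^+ 2 + B ^+ 3) - X (u * B ^+ 2), these are the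
   increments of V and V' over [u, u + dl]. *)
Definition bridge_G (w : Omega) : R :=
  (X (u + dl + B) w - X (u + B) w) - (X (u + dl) w - X u w).
Definition bridge_Y (w : Omega) : R :=
  (X ((u + dl) * B ^+ 2 + B ^+ 3) w - X ((u + dl) * B ^+ 2) w) -
  (X (u * B ^+ 2 + B ^+ 3) w - X (u * B ^+ 2) w).

Let cG := dkappa (u + B) dl - dkappa u dl.
Let cN := dkappa (u * B ^+ 2 + B ^+ 3) (dl * B ^+ 2) - dkappa (u * B ^+ 2) (dl * B ^+ 2)
  + alpha * (dkappa (u * B + B ^+ 2) (dl * B) - dkappa (u * B) (dl * B)).
Let I1 := incr W (u + B) dl.
Let I2 := incr W u dl.
Let J1 := incr W (u * B ^+ 2 + B ^+ 3) (dl * B ^+ 2).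
Let J2 := incr W (u * B ^+ 2) (dl * B ^+ 2).
Let J3 := incr W (u * B + B ^+ 2) (dl * B).
Let J4 := incr W (u * B) (dl * B).

(** Only linear combinations of W are known to be Gaussian, so [bridge_Y] is put in this form: noise
    from the two finer scales, signal with factor alpha^2, and in both the term in W 1 due to
    kappa. *)
Definition noise_list : seq (R * R) :=
  incr_list (u * B ^+ 2 + B ^+ 3) (dl * B ^+ 2) ++
  scale_coefs (-1) (incr_list (u * B ^+ 2) (dl * B ^+ 2)) ++
  scale_coefs alpha (incr_list (u * B + B ^+ 2) (dl * B)) ++
  scale_coefs (- alpha) (incr_list (u * B) (dl * B)) ++ [:: (- cN, 1)].
Definition signal_list : seq (R * R) :=
  incr_list (u + B) dl ++ scale_coefs (-1) (incr_list u dl) ++ [:: (- cG, 1)].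
Definition Y_list := noise_list ++ scale_coefs (alpha ^+ 2) signal_list.
Definition Y_sd := Num.sqrt (lincov H Y_list Y_list).

Lemma bridge_u_ge0 : 0 <= u.
Proof. by have [B0 B1] := base_inv; have [[]] := grid_gaps B0 B1 uge dl0 ule. Qed.

Lemma bridge_u_lt1 : u + dl + B < 1.
Proof.
have [B0 B1] := base_inv; have [_ _ [h _ _ _] _ _] := grid_gaps B0 B1 uge dl0 ule.
by rewrite addrAC.
Qed.

Lemma bridge_GE w : bridge_G w = I1 w - I2 w - cG * W 1 w.
Proof.
have [B0 _] := base_inv; have u0 := bridge_u_ge0; have uB1 := bridge_u_lt1; have hdl := dl0.
have -> : bridge_G w = (X (u + dl + B) w - X (u + dl) w) - (X (u + B) w - X u w).
  by rewrite /bridge_G; ring.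
rewrite !bridge_shift1//; [|lra|lra].
rewrite /I1 /I2 /incr /cG /dkappa.
by rewrite (addrAC u dl B); ring.
Qed.

Lemma bridge_YE w : bridge_Y w =
  J1 w - J2 w + alpha * (J3 w - J4 w) - cN * W 1 w + alpha ^+ 2 * bridge_G w.
Proof.
have [B0 _] := base_inv; have u0 := bridge_u_ge0; have uB1 := bridge_u_lt1; have hdl := dl0.
rewrite bridge_GE /bridge_Y !bridge_shift3//; [|lra|lra].
rewrite /I1 /I2 /J1 /J2 /J3 /J4 /incr /cG /cN /dkappa.
rewrite (addrAC u dl B).
have -> : (u + dl) * B ^+ 2 + B ^+ 3 = u * B ^+ 2 + B ^+ 3 + dl * B ^+ 2 by ring.
have -> : (u + dl) * B ^+ 2 = u * B ^+ 2 + dl * B ^+ 2 by ring.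
have -> : (u + dl) * B + B ^+ 2 = u * B + B ^+ 2 + dl * B by ring.
have -> : (u + dl) * B = u * B + dl * B by ring.
by ring.
Qed.

Lemma bridge_Y_lincomb : bridge_Y = lincomb W Y_list.
Proof.
apply/funext => w; rewrite bridge_YE bridge_GE.
rewrite /Y_list /noise_list /signal_list !lincomb_cat !lincomb_scale !lincomb_cat.
rewrite !lincomb_scale -!incrE /lincomb !big_seq1/=.
by rewrite /I1 /I2 /J1 /J2 /J3 /J4; ring.
Qed.

Lemma Y_list_ge0 : times_ge0 Y_list.
Proof.
have [B0 B1] := base_inv; have u0 := bridge_u_ge0; have dl0' := ltW dl0; have B0' := ltW B0.
have sc c l : times_ge0 (scale_coefs c l) = times_ge0 l by rewrite /times_ge0 all_map.
have ct l m : times_ge0 (l ++ m) = times_ge0 l && times_ge0 m by rewrite /times_ge0 all_cat.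
rewrite /Y_list /noise_list /signal_list !(ct, sc) !incr_list_ge0 ?addr_ge0 ?mulr_ge0 ?exprn_ge0//.
by rewrite /times_ge0/= ler01.
Qed.

Local Notation sm := (Num.sqrt (@normal_m2 R)).
Local Notation gap_const := (`|2 * H * (2 * H - 1)| * (B ^+ 5) `^ (2 * H - 2)).
Local Notation eps := (alpha ^+ 2 / 30).

(** Both smallness conditions hold for a fine mesh, as 2 - 2 H > 0 and tau - H > 0; alpha^2 / 30 is
    the largest error allowed by [correlation_lower_bound]. *)
Hypothesis small_cov : gap_const * dl `^ (2 - 2 * H) <= eps.
Hypothesis small_kappa : 4 * `|C| * dl `^ (tau - H) <= eps.

Lemma dkappa_le s h : 0 <= s -> 0 <= h -> h <= dl -> s + h <= 1 ->
  `|dkappa s h| <= `|C| * dl `^ tau.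
Proof.
move=> s0 h0 hdl sh; have tau0 : 0 <= tau.
  by case/andP: Htau => h1 _; case/andP: H01 => h2 _; lra.
have := @kappaC s (s + h); rewrite /dkappa => /(_ _ _)/le_trans; apply.
- by apply/andP; split; lra.
- by apply/andP; split; lra.
have -> : `|s + h - s| = h by rewrite addrAC subrr add0r ger0_norm.
apply: (@le_trans _ _ (`|C| * h `^ tau)).
  by rewrite ler_wpM2r ?powR_ge0// ler_norm.
by rewrite ler_wpM2l// ge0_ler_powR ?nnegrE// ltW.
Qed.

Lemma dkappa_combination_le :
  `|cG| <= 4 * (`|C| * dl `^ tau) /\ `|cN| <= 4 * (`|C| * dl `^ tau).
Proof.
have [B0 B1] := base_inv; have [al0 al1] : 0 < alpha /\ alpha < 1 by case/andP: alpha01.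
have [[u0 uB0 uB20] [dB0 dBle dB20 dB2le] [s1 s2 s3 [s4 [s5 s6]]] _ _] :=
  grid_gaps B0 B1 uge dl0 ule.
have k0 : 0 <= `|C| * dl `^ tau by rewrite mulr_ge0 ?powR_ge0.
have h1 := dkappa_le (addr_ge0 u0 (ltW B0)) (ltW dl0) (lexx dl) (ltW s1).
have h2 := dkappa_le u0 (ltW dl0) (lexx dl) s2.
have h3 := dkappa_le (addr_ge0 uB20 (exprn_ge0 3 (ltW B0))) dB20 dB2le s4.
have h4 := dkappa_le uB20 dB20 dB2le s6.
have h5 := dkappa_le (addr_ge0 uB0 (exprn_ge0 2 (ltW B0))) dB0 dBle s3.
have h6 := dkappa_le uB0 dB0 dBle s5.
have comb (x y z t k : R) : 0 <= k -> `|x| <= k -> `|y| <= k -> `|z| <= k -> `|t| <= k ->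
    `|x - y + alpha * (z - t)| <= 4 * k.
  move=> {}k0 hx hy hz ht; rewrite (le_trans (ler_normD _ _))// normrM (gtr0_norm al0).
  have : alpha * `|z - t| <= 1 * `|z - t| by rewrite ler_wpM2r// ltW.
  by have := ler_normB x y; have := ler_normB z t; lra.
split; last exact: comb.
have := comb _ _ 0 0 _ k0 h1 h2; rewrite normr0 subrr mulr0 addr0; exact.
Qed.

(** The constant 16: E[Y G] >= (alpha^2 / 2) |G|_2^2 and |Y|_2 <= 8 |G|_2 give E[Y G] >= (alpha^2 /
    16) |Y|_2 |G|_2, where |Y|_2 is [sm * Y_sd]. *)
Lemma bridge_correlation :
  [/\ L2 P bridge_G, sm * dl `^ H <= nrm2 P bridge_G, 0 < lincov H Y_list Y_list &
    (sm * alpha ^+ 2 / 16) * nrm2 P bridge_G <=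
      Y_sd^-1 * Ex P (fun w => bridge_Y w * bridge_G w)].
Proof.
have [B0 B1] := base_inv.
have [[u0 uB0 uB20] [dB0 dBle dB20 dB2le] _ [g1 g2 g3 g4] [g5 g6]] :=
  grid_gaps B0 B1 uge dl0 ule.
have uleB : u <= u + B by rewrite lerDl ltW.
have [al0 al1] : 0 < alpha /\ alpha < 1 by case/andP: alpha01.
have [H0 H1] : 0 < H /\ H < 1 by case/andP: H01.
have dl0' := ltW dl0.
have sm0 : 0 < sm by rewrite sqrtr_gt0 normal_m2_gt0.
have smE : sm ^+ 2 = normal_m2 by rewrite sqr_sqrtr// ltW// normal_m2_gt0.
pose a := sm * dl `^ H.
have dH0 : 0 < dl `^ H by exact: powR_gt0.
have a0 : 0 < a by rewrite mulr_gt0.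
have LW1 := fBm_L2 H0 fW (ler01 : 0 <= (1 : R)).
have nW1 : nrm2 P (W 1) = sm by rewrite /nrm2 LW1.2 powR1 mulr1.
have incrle s h : 0 <= s -> 0 <= h -> h <= dl -> nrm2 P (incr W s h) <= a.
  move=> s0 h0 hd; rewrite (nrm2_incr H01 fW)// /a ler_wpM2l ?(ltW sm0)//.
  by rewrite ge0_ler_powR ?nnegrE// ltW.
have knorm c : `|c| <= 4 * (`|C| * dl `^ tau) -> nrm2 P (fun w => c * W 1 w) <= eps * a.
  move=> hc; rewrite nrm2Z; last exact: LW1.1.
  rewrite nW1 /a mulrCA mulrC ler_wpM2l ?(ltW sm0)// (le_trans hc)//.
  have -> : dl `^ tau = dl `^ (tau - H) * dl `^ H.
    by rewrite -powRD ?subrK//; apply/implyP => _; rewrite gt_eqF.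
  by rewrite !mulrA ler_wpM2r ?(ltW dH0).
have covle s h c k : 0 <= s -> 0 <= h -> h <= dl -> 0 <= k -> k <= dl -> s + h + B ^+ 5 <= c ->
    `|Ex P (fun w => incr W s h w * incr W c k w)| <= eps * a ^+ 2.
  move=> s0 h0 hd k0 kd gap.
  have g0 : 0 < B ^+ 5 by exact: exprn_gt0.
  apply: (le_trans (incr_cov_le H01 fW g0 s0 h0 k0 gap)).
  rewrite /a exprMn smE [leRHS]mulrCA ler_wpM2l ?(ltW normal_m2_gt0)//.
  (* h k <= dl^2, split so that the variance factor (dl^H)^2 appears. *)
  have hk : h * k <= dl `^ (2 - 2 * H) * (dl `^ H) ^+ 2.
    rewrite -powR_mulrn ?powR_ge0// -powRrM -powRD; last first.
      by apply/implyP => _; rewrite gt_eqF.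
    have -> : 2 - 2 * H + H * 2 = 2 by ring.
    by rewrite powR_mulrn// expr2 ler_pM.
  rewrite -mulrA; apply: (le_trans (ler_wpM2l _ hk)).
    by rewrite mulr_ge0 ?powR_ge0.
  by rewrite mulrA ler_wpM2r// exprn_ge0// ltW.
have covC f g : `|Ex P (fun w => g w * f w)| <= eps * a ^+ 2 ->
    `|Ex P (fun w => f w * g w)| <= eps * a ^+ 2.
  by congr (`|Ex P _| <= _); apply/funext => w; rewrite mulrC.
have [cGle cNle] := dkappa_combination_le.
have L2i s h : 0 <= s -> 0 <= h -> L2 P (incr W s h).
  by move=> s0 h0; exact: (incr_L2 H01 fW).
have al01' : 0 < alpha <= 1 by rewrite al0 ltW.
have e0 : 0 <= eps by rewrite divr_ge0// sqr_ge0.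
have e30 : 30 * eps <= alpha ^+ 2 by rewrite mulrC divfK.
have [B20 B30] : 0 <= B ^+ 2 /\ 0 <= B ^+ 3 by rewrite !exprn_ge0// ltW.
have uB : 0 <= u + B by exact: addr_ge0 u0 (ltW B0).
have uB3 : 0 <= u * B ^+ 2 + B ^+ 3 by exact: addr_ge0.
have uB2 : 0 <= u * B + B ^+ 2 by exact: addr_ge0.
have LI1 : L2 P I1 by exact: L2i.
have LI2 : L2 P I2 by exact: L2i.
have LJ1 : L2 P J1 by exact: L2i.
have LJ2 : L2 P J2 by exact: L2i.
have LJ3 : L2 P J3 by exact: L2i.
have LJ4 : L2 P J4 by exact: L2i.
have LKG : L2 P (fun w => cG * W 1 w) by apply: L2Z; exact: LW1.1.
have LKN : L2 P (fun w => cN * W 1 w) by apply: L2Z; exact: LW1.1.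
have nI1 : nrm2 P I1 = a by rewrite (nrm2_incr H01 fW).
have nI2 : nrm2 P I2 = a by rewrite (nrm2_incr H01 fW).
have nJ1 : nrm2 P J1 <= a by exact: incrle.
have nJ2 : nrm2 P J2 <= a by exact: incrle.
have nJ3 : nrm2 P J3 <= a by exact: incrle.
have nJ4 : nrm2 P J4 <= a by exact: incrle.
have cI : `|Ex P (fun w => I2 w * I1 w)| <= eps * a ^+ 2 by exact: covle.
(* Every J interval lies before both I intervals, except that of [J3], which lies between those of
   [I2] and [I1]; hence the one case without [covC]. *)
have cIJ I : I = I1 \/ I = I2 -> forall J, [\/ J = J1, J = J2, J = J3 | J = J4] ->
    `|Ex P (fun w => I w * J w)| <= eps * a ^+ 2.
  case=> -> J [] ->.
  - by apply: covC; apply: covle => //; exact: le_trans g2 uleB.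
  - by apply: covC; apply: covle => //; exact: le_trans g3 uleB.
  - by apply: covC; exact: covle.
  - by apply: covC; apply: covle => //; exact: le_trans g4 uleB.
  - by apply: covC; exact: covle.
  - by apply: covC; exact: covle.
  - exact: covle.
  - by apply: covC; exact: covle.
have := correlation_lower_bound al01' a0 e0 e30 LI1 LI2 LJ1 LJ2 LJ3 LJ4 LKG LKN nI1 nI2
  nJ1 nJ2 nJ3 nJ4 (knorm _ cGle) (knorm _ cNle) cI cIJ.
have GE : (fun w => I1 w - I2 w - cG * W 1 w) = bridge_G.
  by apply/funext => w; rewrite bridge_GE.
have YE : (fun w => J1 w - J2 w + alpha * (J3 w - J4 w) - cN * W 1 w +
    alpha ^+ 2 * (I1 w - I2 w - cG * W 1 w)) = bridge_Y.
  by apply/funext => w; rewrite bridge_YE bridge_GE.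
rewrite /= GE YE => -[aG YG].
rewrite [X in _ <= Ex P X](_ : _ = fun w => bridge_Y w * bridge_G w); last first.
  by apply/funext => w; rewrite bridge_YE !bridge_GE.
move=> cYG.
have LG : L2 P bridge_G by rewrite -GE; apply: L2B => //; exact: L2B.
have nY : nrm2 P bridge_Y = sm * Y_sd.
  rewrite bridge_Y_lincomb (nrm2_lincomb H0 fW)//; exact: Y_list_ge0.
have G0 : 0 < nrm2 P bridge_G by exact: lt_le_trans aG.
have al20 : 0 < alpha ^+ 2 by exact: exprn_gt0.
have LY : L2 P bridge_Y by rewrite bridge_Y_lincomb; apply: (lincomb_L2 H0 fW); exact: Y_list_ge0.
have YGp : 0 < Ex P (fun w => bridge_Y w * bridge_G w).
  by apply: (lt_le_trans _ cYG); rewrite !mulr_gt0// exprn_gt0.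
(* A variable with nonzero correlation to G cannot be degenerate. *)
have sd0 : 0 < Y_sd.
  have := le_trans (ler_norm _) (cauchy_schwarz_Ex LY LG).
  rewrite nY => /(lt_le_trans YGp); rewrite pmulr_lgt0// pmulr_rgt0//.
have v0 : 0 < lincov H Y_list Y_list by rewrite -sqrtr_gt0.
split => //.
rewrite [leRHS]mulrC ler_pdivlMr//.
apply: (le_trans _ cYG).
have -> : sm * alpha ^+ 2 / 16 * nrm2 P bridge_G * Y_sd =
  alpha ^+ 2 / 16 * nrm2 P bridge_G * (sm * Y_sd) by ring.
rewrite -nY.
have : alpha ^+ 2 / 16 * nrm2 P bridge_G * nrm2 P bridge_Y <=
  alpha ^+ 2 / 16 * nrm2 P bridge_G * (8 * nrm2 P bridge_G).
  by rewrite ler_wpM2l// mulr_ge0 ?divr_ge0 ?ltW.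
have -> : alpha ^+ 2 / 16 * nrm2 P bridge_G * (8 * nrm2 P bridge_G) =
  alpha ^+ 2 / 2 * nrm2 P bridge_G ^+ 2 by field.
by [].
Qed.

(** Normalizing by [Y_sd] lets the same L serve every interval; the factor 1 / L brings the weight
    into [-1, 1]. *)
Definition bridge_weight (L : R) (w : Omega) : R := L^-1 * clip L (Y_sd^-1 * bridge_Y w).

Lemma bridge_weight_le1 L w : 0 < L -> `|bridge_weight L w| <= 1.
Proof.
move=> L0; rewrite normrM gtr0_norm ?invr_gt0// mulrC ler_pdivrMr// mul1r.
exact/clip_le/ltW.
Qed.

(** Clipping at this L loses at most half of the correlation sm alpha^2 / 16, whence 32; the further
    factor 1 / L is that of the weight. *)
Lemma bridge_weight_mean L : 0 < L -> Num.sqrt (normal_tail L) <= sm * alpha ^+ 2 / 32 ->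
  [/\ L2 P (fun w => bridge_weight L w * bridge_G w),
    nrm2 P (fun w => bridge_weight L w * bridge_G w) <= nrm2 P bridge_G,
    sm * dl `^ H <= nrm2 P bridge_G &
    sm * alpha ^+ 2 / 32 / L * nrm2 P bridge_G <= Ex P (fun w => bridge_weight L w * bridge_G w)].
Proof.
move=> L0 tailL; have [LG aG v0 corr] := bridge_correlation.
have H0 : 0 < H by case/andP: H01.
have LY : L2 P bridge_Y.
  by rewrite bridge_Y_lincomb; apply: (lincomb_L2 H0 fW); exact: Y_list_ge0.
have mc : measurable_fun setT (fun w => clip L (Y_sd^-1 * bridge_Y w)).
  apply: measurableT_comp; first exact: measurable_clip.
  by apply: measurable_funM => //; exact: LY.1.
have mw : measurable_fun setT (bridge_weight L) by apply: measurable_funM.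
have Lw : L2 P (fun w => bridge_weight L w * bridge_G w).
  exact: (L2_bounded_mul mw (fun w => bridge_weight_le1 w L0) LG).
split => //.
  apply: nrm2_le => // w; rewrite normrM ler_piMl//; exact: bridge_weight_le1.
have Lc : L1 P (fun w => clip L (Y_sd^-1 * bridge_Y w) * bridge_G w).
  apply: (L1_bounded_mul mc (K := L)); last exact: L2_L1.
  by move=> w; exact/clip_le/ltW.
have -> : (fun w => bridge_weight L w * bridge_G w) =
    (fun w => L^-1 * (clip L (Y_sd^-1 * bridge_Y w) * bridge_G w)).
  by apply/funext => w; rewrite /bridge_weight mulrA.
rewrite ExZ// [X in X <= _](_ : _ = L^-1 * (sm * alpha ^+ 2 / 32 * nrm2 P bridge_G)); last first.
  by field; rewrite gt_eqF.
rewrite ler_wpM2l ?invr_ge0 ?(ltW L0)//.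
have := Ex_clip_lincomb H0 fW L Y_list_ge0 v0 LG.
rewrite -bridge_Y_lincomb -/Y_sd; apply: le_trans.
have : Num.sqrt (normal_tail L) * nrm2 P bridge_G <= sm * alpha ^+ 2 / 32 * nrm2 P bridge_G.
  by rewrite ler_wpM2r ?nrm2_ge0.
by move: corr; lra.
Qed.

End bridge_increments.

Theorem theorem2p5 (R : realType) (d : measure_display)
  (Omega : measurableType d) (P : probability Omega R)
  (H alpha : R) (b : nat) (W : R -> Omega -> R) (kappa : R -> R) (tau : R) :
  0 < H < 1 -> 0 < alpha < 1 -> (2 <= b)%N ->
  is_fBm P H W ->
  (forall t, 0 <= t <= 1 -> 0 <= kappa t <= 1) ->
  kappa 0 = 0 -> kappa 1 = 1 ->
  H < tau <= 1 ->
  (exists C : R, forall s t, 0 <= s <= 1 -> 0 <= t <= 1 ->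
     `|kappa t - kappa s| <= C * `|t - s| `^ tau) ->
  forall F : R -> set (set Omega), filtration F ->
    ~ semimartingale P F (fWW_bridge alpha b W kappa).
Proof.
move=> H01 alpha01 b2 fW kappa01 _ _ Htau [C kappaC] F filF semi.
set X := fWW_bridge alpha b W kappa in semi.
pose B : R := b%:R^-1; have BE : B = b%:R^-1 by [].
have [B0 B1] := base_inv b2 BE.
have B5 : 0 < B ^+ 5 by exact: exprn_gt0.
have [al0 al1] : 0 < alpha /\ alpha < 1 by case/andP: alpha01.
have [H0 H1] : 0 < H /\ H < 1 by case/andP: H01.
pose sm : R := Num.sqrt normal_m2.
have sm0 : 0 < sm by rewrite sqrtr_gt0 normal_m2_gt0.
pose rho := sm * alpha ^+ 2 / 32.
have rho0 : 0 < rho by rewrite divr_gt0// mulr_gt0// exprn_gt0.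
(* L depends on alpha but not on the mesh, so rho / L is a fixed gain. *)
have [L L0 tailL] : exists2 L, 0 < L & Num.sqrt (normal_tail L) <= rho.
  have [|L L0 hL] := @normal_tail_small R (rho ^+ 2); first exact: exprn_gt0.
  exists L => //; rewrite -[rho]gtr0_norm// -sqrtr_sqr; exact: ler_wsqrtr.
(* For u in [B^2, B^2 + B^5] the increments of V' involve X only up to time B^2, so the weights are
   known before the increments of V, which are differences of increments of X along [tR] and [tL]. *)
pose dl n : R := B ^+ 5 / n%:R.
(* [minn] keeps the grid constant after n steps, since the tightness lemma asks for points of [0, 1]
   at all j; for n = 0, [dl] is 0 by convention. *)
pose tL n j : R := B ^+ 2 + (minn j n)%:R * dl n.
pose tR n j : R := tL n j + B.
have B2le : B ^+ 2 <= 1 / 4.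
  rewrite (_ : 1 / 4 = (1 / 2) ^+ 2); last by field.
  by rewrite lerXn2r ?nnegrE ?(ltW B0)//; lra.
have B5le : 8 * B ^+ 5 <= B ^+ 2.
  have : B ^+ 3 <= 1 / 8.
    rewrite (_ : 1 / 8 = (1 / 2) ^+ 3); last by field.
    by rewrite lerXn2r ?nnegrE ?(ltW B0)//; lra.
  rewrite (_ : B ^+ 5 = B ^+ 3 * B ^+ 2); last by ring.
  have : 0 <= B ^+ 2 by rewrite exprn_ge0// ltW.
  by nra.
have dl_ge0 n : 0 <= dl n by rewrite divr_ge0// ltW.
have dlle n : dl n <= B ^+ 5.
  case: n => [|n]; first by rewrite /dl invr0 mulr0 ltW.
  by rewrite /dl ler_pdivrMr// ler_peMr ?(ltW B5)// ler1n.
have tLlo n j : B ^+ 2 <= tL n j by rewrite lerDl mulr_ge0.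
have tLhi n j : tL n j <= B ^+ 2 + B ^+ 5.
  rewrite lerD2l; case: n => [|n]; first by rewrite minn0 mul0r ltW.
  by rewrite mulrCA ler_piMr ?(ltW B5)// ler_pdivrMr// mul1r ler_nat geq_minr.
have tLm n j : tL n j <= tL n j.+1.
  rewrite lerD2l ler_wpM2r// ler_nat leq_min geq_minr andbT.
  by rewrite (leq_trans (geq_minl _ _)).
have tLS n j : (j < n)%N -> tL n j.+1 = tL n j + dl n.
  move=> jn; rewrite /tL (minn_idPl jn) (minn_idPl (ltnW jn)) -natr1; ring.
have B2ge0 : 0 <= B ^+ 2 by rewrite exprn_ge0// ltW.
have tL01 n j : 0 <= tL n j <= 1.
  by have := tLlo n j; have := tLhi n j => h1 h2; apply/andP; split; lra.
have tR01 n j : 0 <= tR n j <= 1.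
  by have := tLlo n j; have := tLhi n j => h1 h2; rewrite /tR; apply/andP; split; lra.
have tRm n j : tR n j <= tR n j.+1 by rewrite lerD2r.
pose G n j := bridge_G alpha b W kappa B (tL n j) (dl n).
pose theta n j := bridge_weight H alpha b W kappa B (tL n j) (dl n) L.
have theta1 n j w : `|theta n j w| <= 1 by exact: bridge_weight_le1.
(* Measurability is read off the definition of [bridge_Y] through X: its expression through W
   involves times after B^2, among them 1. *)
have mtheta n j : measurable_wrt (F (B ^+ 2)) (theta n j).
  have B201 : 0 <= B ^+ 2 <= 1 by apply/andP; split; lra.
  have sF : sub_algebra (F (B ^+ 2)) by exact: filtration_sub_algebra.
  have mX s : 0 <= s -> s <= B ^+ 2 ->
      measurable_fun setT (X s : g_sigma_algebraType (F (B ^+ 2)) -> R).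
    move=> s0 sB; apply/measurable_wrtP => // A mA.
    have s01 : 0 <= s <= 1 by apply/andP; split => //; lra.
    apply: (filF.2 s (B ^+ 2)) => //; first by lra.
    exact: semi.1.
  have t0 : 0 <= tL n j by have := tL01 n j => /andP[].
  have B3 : B ^+ 3 <= B ^+ 2 / 2.
    rewrite exprS; have := B2ge0; nra.
  have B30 : 0 <= B ^+ 3 by rewrite exprn_ge0// ltW.
  (* The last time used by the weight is at most (3/8 + 1/32 + 1/2) B^2 < B^2. *)
  have tB : tL n j * B ^+ 2 <= 3 / 8 * B ^+ 2.
    rewrite ler_wpM2r//; have := tLhi n j; lra.
  have dB : dl n * B ^+ 2 <= 1 / 32 * B ^+ 2.
    rewrite ler_wpM2r//; have := dlle n; lra.
  have tB0 : 0 <= tL n j * B ^+ 2 by rewrite mulr_ge0.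
  have dB0 : 0 <= dl n * B ^+ 2 by rewrite mulr_ge0.
  have tdB : (tL n j + dl n) * B ^+ 2 = tL n j * B ^+ 2 + dl n * B ^+ 2 by ring.
  apply/measurable_wrtP => //.
  apply: measurable_funM => //; apply: measurableT_comp; first exact: measurable_clip.
  apply: measurable_funM => //.
  by apply: measurable_funB; apply: measurable_funB; apply: mX; rewrite ?tdB; lra.
have filB n j s : B ^+ 2 <= s -> 0 <= s <= 1 -> measurable_wrt (F s) (theta n j).
  move=> Bs /andP[_ s1]; apply: measurable_wrt_sub (mtheta n j).
  exact: filF.2.
have mthL n j : measurable_wrt (F (tL n j)) (theta n j) by exact: filB.
have mthR n j : measurable_wrt (F (tR n j)) (theta n j).
  by apply: filB => //; rewrite /tR (le_trans (tLlo n j))// lerDl ltW.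
(* The square root of eta is half of the gain rho / L, so in [tight_mean] the term with g is
   absorbed by half of E S. Each of the two transforms along [tL] and [tR] gets eta / 2. *)
pose eta := (rho / (2 * L)) ^+ 2.
have r2L : 0 < rho / (2 * L) by rewrite divr_gt0// mulr_gt0.
have eta0 : 0 < eta / 2 by rewrite divr_gt0// exprn_gt0.
have [KL KL0 hKL] := semimartingale_tight filF tL01 tLm mthL theta1 semi eta0.
have [KR KR0 hKR] := semimartingale_tight filF tR01 tRm mthR theta1 semi eta0.
pose K := KR + KL.
have K0 : 0 < K by exact: addr_gt0.
pose S n w : R := \sum_(j < n) theta n j w * G n j w.
have mX s : 0 <= s <= 1 -> measurable_fun setT (X s).
  move=> s01; apply: (measurable_wrt_measurable (filtration_sub_algebra filF s01)).
  by move=> A mA; exact: semi.1.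
have mth n j : measurable_fun setT (theta n j).
  exact: (measurable_wrt_measurable (filtration_sub_algebra filF (tL01 n j)) (mthL n j)).
have SE n w : S n w = \sum_(j < n) theta n j w * (X (tR n j.+1) w - X (tR n j) w) -
    \sum_(j < n) theta n j w * (X (tL n j.+1) w - X (tL n j) w).
  rewrite -sumrB; apply: eq_bigr => j _.
  by rewrite /G /bridge_G -/X /tR tLS// mulrBr.
have PS n : fine (P [set w | K < `|S n w|]) <= eta.
  pose SR w := \sum_(j < n) theta n j w * (X (tR n j.+1) w - X (tR n j) w).
  pose SL w := \sum_(j < n) theta n j w * (X (tL n j.+1) w - X (tL n j) w).
  have mSR : measurable_fun setT SR.
    apply: measurable_sum => j; apply: measurable_funM => //.
    by apply: measurable_funB; exact: mX.
  have mSL : measurable_fun setT SL.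
    apply: measurable_sum => j; apply: measurable_funM => //.
    by apply: measurable_funB; exact: mX.
  have mgt (f : Omega -> R) k : measurable_fun setT f -> measurable [set w | k < `|f w|].
    by move=> mf; apply: measurable_gt; apply: measurableT_comp.
  have -> : S n = (fun w => SR w - SL w) by apply/funext => w; exact: SE.
  have sub : [set w | K < `|SR w - SL w|] `<=` [set w | KR < `|SR w|] `|` [set w | KL < `|SL w|].
    move=> w /= h; have [|h1] := ltP KR `|SR w|; [by left|right].
    by have := ler_normB (SR w) (SL w); move: h; rewrite /K; lra.
  apply: (le_trans (fine_prob_le P _ _ sub)).
  - by apply: mgt; exact: measurable_funB.
  - by apply: measurableU; exact: mgt.
  apply: (le_trans (fine_probU P _ _)); [exact: mgt|exact: mgt|].
  by have := hKR n; have := hKL n; rewrite -/SR -/SL; lra.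
pose eps := alpha ^+ 2 / 30.
have eps0 : 0 < eps by rewrite divr_gt0// exprn_gt0.
pose gc : R := `|2 * H * (2 * H - 1)| * (B ^+ 5) `^ (2 * H - 2).
have gc0 : 0 <= gc by rewrite mulr_ge0 ?powR_ge0.
(* Chosen so that n dl^H >= B^5 / e3 turns the lower bound for (rho / (2 L)) g into exactly K +
   1. *)
pose e3 := rho / (2 * L) * sm * B ^+ 5 / (K + 1).
have K1 : 0 < K + 1 by rewrite ltr_wpDr.
have e30 : 0 < e3 by rewrite divr_gt0// mulr_gt0// mulr_gt0.
(* The added 1 keeps the quotient meaningful when gc = 0, which happens for H = 1/2. *)
have [n1 hn1] : exists n0 : nat, forall n : nat, (n0 <= n)%N ->
    dl n.+1 `^ (2 - 2 * H) <= eps / (gc + 1).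
  by apply: powR_div_small => //; [lra|rewrite divr_gt0// ltr_wpDl].
have [n2 hn2] : exists n0 : nat, forall n : nat, (n0 <= n)%N ->
    dl n.+1 `^ (tau - H) <= eps / (4 * `|C| + 1).
  apply: powR_div_small => //; first by case/andP: Htau => h _; rewrite subr_gt0.
  by rewrite divr_gt0// ltr_wpDl// mulr_ge0.
have [n3 hn3] : exists n0 : nat, forall n : nat, (n0 <= n)%N -> dl n.+1 `^ (1 - H) <= e3.
  by apply: powR_div_small => //; rewrite subr_gt0.
pose N := maxn n1 (maxn n2 n3); pose n := N.+1.
have {}hn1 := hn1 N (leq_maxl _ _).
have {}hn2 : dl n `^ (tau - H) <= eps / (4 * `|C| + 1).
  by apply: hn2; rewrite !leq_max leqnn orbT.
have {}hn3 : dl n `^ (1 - H) <= e3.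
  by apply: hn3; rewrite !leq_max leqnn !orbT.
have dl0 : 0 < dl n by rewrite divr_gt0.
have mulsmall (x y e : R) : 0 <= x -> 0 <= y -> 0 <= e -> y <= e / (x + 1) -> x * y <= e.
  move=> x0 y0 ee; rewrite ler_pdivlMr ?ltr_wpDl// mulrDr mulr1 mulrC.
  by move: (x * y) => z; lra.
have small_cov : gc * dl n `^ (2 - 2 * H) <= eps.
  by apply: mulsmall => //; [exact: powR_ge0|exact: ltW].
have small_kappa : 4 * `|C| * dl n `^ (tau - H) <= eps.
  by apply: mulsmall => //; [exact: powR_ge0|exact: ltW].
have step (j : 'I_n) : [/\ L2 P (fun w => theta n j w * G n j w),
    nrm2 P (fun w => theta n j w * G n j w) <= nrm2 P (G n j),
    sm * dl n `^ H <= nrm2 P (G n j) &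
    rho / L * nrm2 P (G n j) <= Ex P (fun w => theta n j w * G n j w)].
  have ule : tL n j + dl n <= B ^+ 2 + B ^+ 5 by rewrite -tLS.
  exact: (bridge_weight_mean H01 alpha01 b2 fW kappa01 Htau kappaC BE (tLlo n j) dl0 ule
    small_cov small_kappa L0 tailL).
pose g := \sum_(j < n) nrm2 P (G n j).
have LS : L2 P (S n) by apply: L2_sum => j _; have [] := step j.
have Sg : nrm2 P (S n) <= g.
  apply: (le_trans (nrm2_sum _ _)); first by move=> j; have [] := step j.
  by apply: ler_sum => j _; have [] := step j.
have ES : rho / L * g <= Ex P (S n).
  rewrite Ex_sum => [|j _]; last by have [? _ _ _] := step j; exact: L2_L1.
  by rewrite mulr_sumr; apply: ler_sum => j _; have [] := step j.
have := tight_mean LS (ltW K0) Sg (PS n).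
rewrite sqrtr_sqr gtr0_norm// => /(le_trans ES) main.
have gK : rho / (2 * L) * g <= K.
  have E : rho / L * g = rho / (2 * L) * g + rho / (2 * L) * g by field; rewrite gt_eqF.
  by move: main; rewrite E; lra.
have glow : n%:R * (sm * dl n `^ H) <= g.
  apply: (@le_trans _ _ (\sum_(j < n) sm * dl n `^ H)).
    by rewrite sumr_const card_ord mulr_natl.
  by apply: ler_sum => j _; have [] := step j.
have big : B ^+ 5 / e3 <= n%:R * dl n `^ H.
  rewrite ler_pdivrMr//.
  have E : B ^+ 5 = n%:R * dl n `^ H * dl n `^ (1 - H).
    rewrite -mulrA -powRD; last by rewrite addrC subrK oner_eq0.
    rewrite (_ : H + (1 - H) = 1); last by ring.
    by rewrite powRr1 ?(ltW dl0)// /dl mulrC divfK// pnatr_eq0.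
  by rewrite {1}E ler_wpM2l// mulr_ge0 ?powR_ge0.
have : K + 1 <= rho / (2 * L) * g.
  apply: le_trans (ler_wpM2l (ltW r2L) glow).
  have E : K + 1 = rho / (2 * L) * (sm * (B ^+ 5 / e3)).
    by rewrite /e3; field; rewrite !gt_eqF.
  by rewrite E ler_wpM2l ?(ltW r2L)// [leRHS]mulrCA ler_wpM2l ?(ltW sm0).
by lra.
Qed.
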